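(* Let $\mu$ be a Borel probability measure on $[0,1)$ such that $\Gamma_\mu$ is bounded on $A^1$. Then $\Gamma_\mu$ is compact on $A^1$ if and only if $\mu=\delta_0$, the Dirac point mass at $0$. Nevertheless, for every Borel probability measure $\mu$ on $[0,1)$ such that $\Gamma_\mu$ is bounded on $A^1$, the operator $\Gamma_\mu$ is completely continuous on $A^1$.
   Context: $\mathbb D$ is the open unit disc of $\mathbb C$ and $dA=dx\,dy/\pi$ is normalized area measure. The Bergman space $A^1$ is the Banach space of analytic functions $f$ on $\mathbb D$ with $\|f\|_{A^1}=\int_{\mathbb D}|f|\,dA<\infty$. For a Borel probability measure $\mu$ on $[0,1)$, $$\Gamma_\mu(f)(z)=\int_0^1 f(\varphi_t(z))\,w_t(z)\,d\mu(t),\qquad \varphi_t(z)=\frac{t}{1+(t-1)z},\quad w_t(z)=\frac{1}{1+(t-1)z},\qquad z\in\mathbb D,$$ the integral being over $[0,1)$. ''$\Gamma_\mu$ is bounded on $A^1$'' means that this formula defines a bounded linear operator from $A^1$ to $A^1$. An operator $T$ on a Banach space $X$ is compact if for every bounded sequence $\{x_n\}$ in $X$ the sequence $\{T(x_n)\}$ has a norm convergent subsequence; it is completely continuous if for every weakly convergent sequence $\{x_n\}$ in $X$ the sequence $\{T(x_n)\}$ converges in norm. *)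

(* Defs.v *)
From HB Require Import structures.
From mathcomp Require Import all_boot all_order all_algebra.
From mathcomp Require Import complex.
From mathcomp Require Import all_classical all_reals all_analysis.
From mathcomp Require Import measurable_realfun.

Set Implicit Arguments.
Unset Strict Implicit.
Unset Printing Implicit Defensive.

Import Order.TTheory GRing.Theory Num.Theory.
Import numFieldNormedType.Exports.
Import Normc.

Local Open Scope classical_set_scope.
Local Open Scope ring_scope.
Local Open Scope complex_scope.

Section operators.
Context {K : numFieldType}.

Definition bounded_operator (X Y : normedModType K) (T : X -> Y) : Prop :=
  exists M : K, forall x, `|T x| <= M * `|x|.

Definition weakly_cvg (X : normedModType K) (u : nat -> X) (x : X) : Prop :=
  forall L : {linear X -> K^o}, bounded_operator L ->
    (L (u n) : K^o) @[n --> \oo] --> (L x : K^o).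

Definition compact_operator (X : normedModType K) (T : X -> X) : Prop :=
  forall u : nat -> X, bounded_fun u ->
    exists2 s : nat -> nat, increasing_seq s & cvgn (T \o u \o s).

Definition completely_continuous (X : normedModType K) (T : X -> X) : Prop :=
  forall (u : nat -> X) (x : X), weakly_cvg u x -> cvgn (T \o u).

End operators.

(* R[i]^o is R[i] regarded as a normed module over itself, so that
   [derivable f z 1] below is complex differentiability. *)
Notation cplx R := (R[i]^o) (only parsing).

Section complex_integral.
Context d (T : measurableType d) (R : realType).
Variables (mu : {measure set T -> \bar R}) (D : set T) (f : T -> R[i]).

Definition cintegrable : Prop :=
  mu.-integrable D (fun t => (complex.Re (f t))%:E) /\
  mu.-integrable D (fun t => (complex.Im (f t))%:E).

Definition cintegral : R[i] :=
  (\int[mu]_(t in D) complex.Re (f t)) +i* (\int[mu]_(t in D) complex.Im (f t)).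

End complex_integral.

Section bergman.
Context {R : realType}.
Local Notation C := (cplx R).
Implicit Types (f g : C -> C) (z : C).

Definition disc : set C := [set z | normc z < 1].

Definition of_plane (p : R * R) : C := p.1 +i* p.2.

Definition plane_disc : set (R * R) := of_plane @^-1` disc.

Definition analytic_disc f : Prop := forall z, disc z -> derivable f z 1.

Definition plane_lebesgue :
    {measure set (measurableTypeR R * measurableTypeR R) -> \bar R} :=
  (@lebesgue_measure R \x @lebesgue_measure R)%E.

(* The integral of |f| over the disc for dA = dx dy / pi. *)
Definition bergman_enorm f : \bar R :=
  ((pi : R)^-1%:E *
    \int[plane_lebesgue]_(p in plane_disc) (normc (f (of_plane p)))%:E)%E.

(* Only the values on the disc matter; requiring f to vanish off the disc
   makes two elements with the same restriction to the disc equal. *)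
Definition bergman_fun f : Prop :=
  [/\ analytic_disc f, (bergman_enorm f < +oo)%E &
    forall z, ~ disc z -> f z = 0].

End bergman.

Section bergman_theory.
Context {R : realType}.
Local Notation C := (cplx R).
Implicit Types (f g : C -> C) (z w : C).

Lemma normC_normc (z : R[i]) : `|z| = (normc z)%:C.
Proof. by case: z. Qed.

Lemma normc_ge0 z : 0 <= normc z.
Proof. by case: z => a b; exact: sqrtr_ge0. Qed.

Lemma normc_dist z w : `|normc z - normc w| <= normc (z - w : C).
Proof.
rewrite -lecR -!normC_normc.
have -> : (`|normc z - normc w|)%:C = `| `|z : R[i]| - `|w : R[i]| | :> R[i].
  by rewrite !normC_normc -rmorphB /= expr0n addr0 sqrtr_sqr.
exact: ler_dist_dist.
Qed.

Lemma normc_continuous : continuous (@normc R : C -> R).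
Proof.
move=> z; apply/(@cvgrPdist_lt _ R^o C (nbhs z)) => e e0.
apply/(@nbhs_ballP _ C); exists e%:C; first by rewrite /= ltcR.
move=> w; rewrite -ball_normE /= normC_normc ltcR.
exact: le_lt_trans (normc_dist _ _).
Qed.

Lemma of_plane_continuous : continuous (of_plane : R * R -> C).
Proof.
move=> p; apply/(@cvgrPdist_lt _ C _ (nbhs p)) => e e0.
have e0' : 0 < complex.Re e by move: e0; rewrite ltcE => /andP[_].
have -> : e = (complex.Re e)%:C by rewrite RRe_real// gtr0_real.
near=> q.
have -> : of_plane p - of_plane q = (p.1 - q.1)%:C + 'i%C * (p.2 - q.2)%:C.
  rewrite /of_plane; apply/eqP; rewrite eq_complex /=.
  by rewrite !(mul0r, mul1r, mulr0, addr0, add0r, subr0) !eqxx.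
apply: le_lt_trans (ler_normD _ _) _.
rewrite normrM !normC_normc -!rmorphM -!rmorphD ltcR /=.
rewrite !(expr0n, expr1n, addr0, add0r) /= sqrtr1 mul1r !sqrtr_sqr.
rewrite [ltRHS]splitr ltrD//; near: q.
  by apply: (@cvgr_dist_lt _ R^o _ _ _ _ p.1 cvg_fst); rewrite divr_gt0.
by apply: (@cvgr_dist_lt _ R^o _ _ _ _ p.2 cvg_snd); rewrite divr_gt0.
Unshelve. all: by end_near. Qed.

Lemma rat_box (U : set (R * R)) p : open U -> U p ->
  exists a b c d : rat, [/\ p.1 \in `]ratr a, ratr b[, p.2 \in `]ratr c, ratr d[
    & `]ratr a, (ratr b : R)[%classic `*` `]ratr c, (ratr d:R)[%classic `<=` U].
Proof.
move=> oU Up.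
have [e/= e0 eU] : exists2 e, 0 < e & ball p e `<=` U.
  have /nbhs_ballP[e /= e0 eU] := open_nbhs_nbhs (conj oU Up).
  by exists e.
have H (x : R) : exists a b : rat,
    (x \in `]ratr a, ratr b[) /\
    (`]ratr a, ratr b[%classic `<=` ball x e).
  have /rat_in_itvoo[a] : x - e < x by rewrite ltrBlDr ltrDl.
  have /rat_in_itvoo[b] : x < x + e by rewrite ltrDl.
  rewrite !in_itv/= => /andP[b1 b2] /andP[a1 a2].
  exists a, b; split; first by rewrite in_itv/= a2 b1.
  move=> y /=; rewrite in_itv/= => /andP[ay yb].
  rewrite ball_itv /= in_itv /= (lt_trans a1 ay) (lt_trans yb b2).
  by [].
have [a [b [ab abU]]] := H p.1.
have [c [d [cd cdU]]] := H p.2.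
exists a, b, c, d; split => // -[x y] [/= xab ycd].
by apply: eU; split => /=; [exact: abU|exact: cdU].
Qed.

Lemma open_measurable_plane (U : set (R * R)) : open U -> measurable U.
Proof.
move=> oU.
pose B a b c d : set (R * R) :=
  `]ratr a, (ratr b : R)[%classic `*` `]ratr c, (ratr d:R)[%classic.
have -> : U = \bigcup_a \bigcup_b \bigcup_c \bigcup_d
   (if `[< B a b c d `<=` U >] then B a b c d else set0).
  apply/seteqP; split => [p Up|p [a _ [b _ [c _ [d _]]]]]; last first.
    by case: ifPn => // /asboolP; apply.
  have [a [b [c [d [ab cd BU]]]]] := rat_box oU Up.
  exists a => //; exists b => //; exists c => //; exists d => //.
  by rewrite (asboolT BU); split.
do 4 (apply: bigcupT_measurable_rat => ?).
case: ifPn => // _; exact: measurableX.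
Qed.

Lemma open_plane_gt0 (U : set (R * R)) : open U -> U !=set0 ->
  (0 < plane_lebesgue U)%E.
Proof.
move=> oU [p Up].
have [a [b [c [d [ab cd BU]]]]] := rat_box oU Up.
pose A := `]ratr a, (ratr b : R)[%classic.
pose B := `]ratr c, (ratr d : R)[%classic.
have mB : measurable (A `*` B).
  by apply: measurableX; exact: measurable_itv.
have := @le_measure _ _ _ plane_lebesgue _ _ (mem_set mB)
  (mem_set (open_measurable_plane oU)) BU.
apply: lt_le_trans.
have E : plane_lebesgue (A `*` B) =
    (lebesgue_measure A * lebesgue_measure B)%E.
  by apply: product_measure1E; exact: measurable_itv.
rewrite [ltRHS]E !lebesgue_measure_itv /=.
move: ab cd; rewrite !in_itv/= => /andP[/lt_trans a1 /a1 a2].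
move=> /andP[/lt_trans b1 /b1 b2].
rewrite !lte_fin a2 b2 -!EFinD -EFinM lte_fin mulr_gt0 // subr_gt0//.
Qed.

Lemma disc_open : open (@disc R).
Proof.
rewrite (_ : @disc R = (@normc R : C -> R) @^-1` `]-oo, 1[%classic).
  by apply: open_comp => // z _; exact: normc_continuous.
by apply/seteqP; split => z; rewrite /= in_itv.
Qed.

Lemma plane_disc_open : open (@plane_disc R).
Proof.
apply: open_comp; last exact: disc_open.
by move=> p _; exact: of_plane_continuous.
Qed.

Lemma plane_disc_measurable : measurable (@plane_disc R).
Proof. exact: open_measurable_plane plane_disc_open. Qed.

Lemma analytic_continuous f p : analytic_disc f -> plane_disc p ->
  {for p, continuous (fun p => normc (f (of_plane p)))}.
Proof.
move=> af Dp.
apply: (@continuous_comp _ _ _ (f \o of_plane) (@normc R : C -> R)).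
  apply: continuous_comp; first exact: of_plane_continuous.
  exact/differentiable_continuous/derivable1_diffP/af.
exact: normc_continuous.
Qed.

Lemma superlevel_open f a : analytic_disc f ->
  open (plane_disc `&` [set p | a < normc (f (of_plane p))]).
Proof.
move=> af; rewrite openE => p [Dp fp]; apply: filterI.
  exact: open_nbhs_nbhs (conj plane_disc_open Dp).
have := analytic_continuous af Dp.
by move=> /(_ [set x | a < x]); apply; exact: lt_nbhsr.
Qed.

Lemma analytic_measurable f : analytic_disc f ->
  measurable_fun plane_disc (fun p => normc (f (of_plane p))).
Proof.
move=> af; move=> mD.
apply: (measurability _ (measurable_realfun.RGenOInfty.measurableE R)) => //.
move=> _ [_ [a ->] <-].
rewrite (_ : _ `&` _ = plane_disc `&` [set p | a < normc (f (of_plane p))]).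
  by apply: open_measurable_plane; exact: superlevel_open.
by apply/seteqP; split => p /= [Dp]; rewrite in_itv/= andbT.
Qed.

Lemma analytic_emeasurable f : analytic_disc f ->
  measurable_fun plane_disc (fun p => (normc (f (of_plane p)) : R)%:E).
Proof. move=> af; apply/measurable_EFinP; exact: analytic_measurable. Qed.

Lemma bergman_enorm_ge0 f : (0 <= bergman_enorm f)%E.
Proof.
apply: mule_ge0; first by rewrite lee_fin invr_ge0 pi_ge0.
by apply: integral_ge0 => p _; rewrite lee_fin normc_ge0.
Qed.

Lemma bergman_enorm0 : bergman_enorm (0 : C -> C) = 0%E.
Proof.
rewrite /bergman_enorm integral0_eq ?mule0// => p _.
by rewrite normc0.
Qed.

Lemma bergman_enormZ (a : R[i]) f : analytic_disc f ->
  bergman_enorm (a *: f) = ((normc a)%:E * bergman_enorm f)%E.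
Proof.
move=> af; rewrite /bergman_enorm muleCA; congr (_ * _)%E.
rewrite -ge0_integralZl//.
- by apply: eq_integral => p _; rewrite -EFinM -normcM.
- exact: plane_disc_measurable.
- exact: analytic_emeasurable.
- by move=> p _; rewrite lee_fin normc_ge0.
- by rewrite lee_fin normc_ge0.
Qed.

Lemma analytic_discD f g :
  analytic_disc f -> analytic_disc g -> analytic_disc (f + g).
Proof. by move=> af ag z Dz; apply: derivableD; [exact: af|exact: ag]. Qed.

Lemma analytic_discZ (a : R[i]) f : analytic_disc f -> analytic_disc (a *: f).
Proof. by move=> af z Dz; apply: derivableZ; exact: af. Qed.

Lemma bergman_enormD f g : analytic_disc f -> analytic_disc g ->
  (bergman_enorm (f + g)%R <= bergman_enorm f + bergman_enorm g)%E.
Proof.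
move=> af ag; rewrite /bergman_enorm -ge0_muleDr; last 2 first.
- by apply: integral_ge0 => p _; rewrite lee_fin normc_ge0.
- by apply: integral_ge0 => p _; rewrite lee_fin normc_ge0.
apply: lee_wpmul2l; first by rewrite lee_fin invr_ge0 pi_ge0.
have mD := plane_disc_measurable.
rewrite -ge0_integralD//; last 4 first.
- by move=> p _; rewrite lee_fin normc_ge0.
- exact: analytic_emeasurable.
- by move=> p _; rewrite lee_fin normc_ge0.
- exact: analytic_emeasurable.
have H := analytic_emeasurable (analytic_discD af ag).
have Hf := analytic_emeasurable af; have Hg := analytic_emeasurable ag.

apply: (ge0_le_integral plane_lebesgue mD _ H).

- by move=> p _; rewrite lee_fin normc_ge0.
- by apply: emeasurable_funD.
- by move=> p _; rewrite -EFinD lee_fin le_normcD.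
Qed.

Lemma bergman_enorm_eq0 f : analytic_disc f -> bergman_enorm f = 0%E ->
  forall z, disc z -> f z = 0.
Proof.
move=> af /eqP; rewrite mule_eq0 eqe invr_eq0 gt_eqF ?pi_gt0//= => /eqP f0 z Dz.
have [//|fz0] := eqVneq (f z) 0; exfalso.
set U := plane_disc `&` [set p | 0 < normc (f (of_plane p))].
have oU : open U := @superlevel_open f 0 af.
have /(open_plane_gt0 oU) : U !=set0.
  exists (complex.Re z, complex.Im z).
  have zE : of_plane (complex.Re z, complex.Im z) = z by case: (z).
  rewrite /U /plane_disc /= zE; split => //.
  rewrite lt_neqAle normc_ge0 andbT eq_sym.
  by apply: contra fz0 => /eqP/eq0_normc ->.
have mD := plane_disc_measurable.
have : (\int[plane_lebesgue]_(p in plane_disc)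
    `|(normc (f (of_plane p)))%:E| = 0)%E.
  rewrite -[RHS]f0; apply: eq_integral => p _.
  by rewrite gee0_abs// lee_fin normc_ge0.
move=> /ae_eq_integral_abs => /(_ mD (analytic_emeasurable af)) [N [mN N0 UN]].
rewrite ltNge => /negP; apply; rewrite -N0.
apply: le_measure; rewrite ?inE//; first exact: open_measurable_plane.
move=> p [Dp fp]; apply: UN => /= /(_ Dp)/eqP; rewrite eqe.
by rewrite gt_eqF.
Qed.

End bergman_theory.

Section bergman_space.
Variable R : realType.
Local Notation C := (cplx R).

Definition bergman_pred : {pred C -> C} := fun f => `[< bergman_fun f >].

Lemma bergman_pred_submod : submod_closed bergman_pred.
Proof.
split=> [|a f g /asboolP[af nf f0] /asboolP[ag ng g0]]; apply/asboolP; split.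
- by move=> z _; exact: derivable_cst.
- by rewrite bergman_enorm0.
- by [].
- exact: (analytic_discD (analytic_discZ (a := a) af) ag).
- apply: le_lt_trans (bergman_enormD (analytic_discZ (a := a) af) ag) _.
  rewrite bergman_enormZ//; apply: lte_add_pinfty => //.
  by apply: lte_mul_pinfty => //; rewrite lee_fin normc_ge0.
- by move=> z nDz; rewrite !fctE f0// g0// scaler0 addr0.
Qed.

HB.instance Definition _ := GRing.isSubmodClosed.Build _ _ bergman_pred
  bergman_pred_submod.

Record A1 : Type := MkA1 { A1_fun :> C -> C ; _ : A1_fun \in bergman_pred }.

HB.instance Definition _ := [isSub for A1_fun].
HB.instance Definition _ := [Choice of A1 by <:].
HB.instance Definition _ := [SubChoice_isSubLmodule of A1 by <:].

Implicit Types f g : A1.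

Lemma A1P f : bergman_fun f.
Proof. by apply/asboolP; exact: (valP f). Qed.

Definition A1_norm f : R := fine (bergman_enorm f).

Lemma A1_normE f : (A1_norm f)%:E = bergman_enorm f.
Proof.
have [_ nf _] := A1P f.
by rewrite fineK// ge0_fin_numE// bergman_enorm_ge0.
Qed.

(* [normedModType R[i]] takes its norm in R[i]. *)
Let norm f : R[i] := (A1_norm f)%:C.

Let ler_normD f g : norm (f + g) <= norm f + norm g.
Proof.
have [af _ _] := A1P f; have [ag _ _] := A1P g.
have -> : norm f + norm g = (A1_norm f + A1_norm g)%:C by rewrite rmorphD.
rewrite lecR -lee_fin EFinD (A1_normE f) (A1_normE g) (A1_normE (f + g)).
exact: (bergman_enormD af ag).
Qed.

Let normrZ (a : R[i]) f : norm (a *: f) = `|a| * norm f.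
Proof.
have [af _ _] := A1P f.
have -> : `|a| * norm f = (normc a * A1_norm f)%:C.
  by rewrite rmorphM normC_normc.
congr (_%:C); apply: EFin_inj; rewrite EFinM (A1_normE f) (A1_normE (a *: f)).
exact: (bergman_enormZ a af).
Qed.

Let normr0_eq0 f : norm f = 0 -> f = 0.
Proof.
move=> /complexI nf0; apply/val_inj/funext => z /=.
have [af _ f0] := A1P f.
have [Dz|/f0//] := pselect (disc z).
by apply: (bergman_enorm_eq0 af) => //; rewrite -A1_normE nf0.
Qed.

HB.instance Definition _ := Lmodule_isNormed.Build R[i] A1
  ler_normD normrZ normr0_eq0.

Lemma A1_normrE f : `|f| = (A1_norm f)%:C.
Proof. by []. Qed.

End bergman_space.

Section gamma.
Context {R : realType}.

Definition phi (t : R) (z : R[i]) : R[i] := t%:C / (1 + (t - 1)%:C * z).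

Definition weight (t : R) (z : R[i]) : R[i] := (1 + (t - 1)%:C * z)^-1.

(* [T] is the operator Gamma_mu on A^1: the integral defining Gamma_mu(f)(z)
   converges absolutely for every f in A^1 and z in the disc, and its value is
   T(f)(z). *)
Definition is_Gamma (mu : {measure set (measurableTypeR R) -> \bar R})
    (T : A1 R -> A1 R) : Prop :=
  forall (f : A1 R) (z : R[i]), disc z ->
    cintegrable mu `[0, 1[ (fun t => f (phi t z) * weight t z) /\
    T f z = cintegral mu `[0, 1[ (fun t => f (phi t z) * weight t z).

End gamma.

(* Main.v *)
From HB Require Import structures.
Require Import Defs.
From mathcomp Require Import all_boot all_order all_algebra.
From mathcomp Require Import complex.
From mathcomp Require Import all_classical all_reals all_analysis.
From mathcomp Require Import measurable_realfun ring lra.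
Import Order.TTheory GRing.Theory Num.Theory.
Import Normc.
Import numFieldNormedType.Exports.
Local Open Scope classical_set_scope.
Local Open Scope ring_scope.
Set Implicit Arguments.
Unset Strict Implicit.
Unset Printing Implicit Defensive.
Local Open Scope complex_scope.

(** The two halves of the theorem have different reasons.

    Complete continuity. The Bergman space [A1] has the Schur property
    ([schur_property]): a weakly null sequence tends to 0 in norm. Hence every
    bounded operator on [A1] is completely continuous. Two families of bounded
    functionals are enough to see this. First, [|f z|] is at most a constant
    times the integral of [|f|] over a square around [z] ([point_bound]), so
    point evaluations are bounded, a weakly null sequence tends to 0 at every
    point, and if it is norm bounded then it is uniformly bounded on smaller
    discs; by dominated convergence its mass on every smaller disc tends to 0
    ([weakly_null_compact]). Secondly, [f] may be integrated against a bounded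
    measurable function [h] ([pairing]). If the norms of the sequence did not
    tend to 0, one could pick a subsequence whose terms carry almost all their
    mass on pairwise disjoint annuli; letting [h] be the sign of the k-th term
    on the k-th annulus, the integrals against [h] stay away from 0, a
    contradiction ([gliding_hump]).

    The bound for point evaluations comes from Cauchy's formula on rectangles,
    for functions of which only the pointwise complex differentiability is
    known. If [g] is complex differentiable then [Im (g dz)] is a closed form,
    and Goursat's bisection makes its circulation around a rectangle vanish
    ([circulation_eq0]), also when there is one point near which the form is
    merely bounded ([circulation_puncture]). This is used for the difference
    quotient of [f] at the point considered ([cauchy_rectangle]), and the
    resulting estimate by integrals over the four sides is averaged over the
    position of the sides.

    Compactness. If [mu] is the Dirac mass at 0 then [T f] is [f 0] times the
    fixed function [T 1], so [T] has rank one and is compact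
    ([dirac0_compact]). In general every [phi t] with [0 < t < 1] fixes
    the boundary point 1. Consider the functions
    [e ^+ 2 * (z / (1 - (1 - e) * z)) ^+ 4], of bounded norm and concentrated
    at distance about [e] from 1 ([peak_in_A1]). On a window of size [e] next
    to 1 the integrand of [T f], for [f] such a function, lies in a fixed sector around
    the positive half line for all [t], so there is no cancellation and the
    mass of [T f] on the window is at least a fixed multiple of the fourth
    moment of [mu] ([is_Gamma_peak_lower]). A norm limit [g] of a subsequence
    would have to carry that much mass on windows that shrink to the point 1,
    although the integral of [|g|] over them tends to 0. So compactness forces the
    fourth moment to vanish, that is, [mu] lives at 0
    ([compact_no_mass]). *)

(** * Derivatives of rational expressions *)

Section field_derivatives.
Context {K : numFieldType}.
Implicit Types (f g : K^o -> K^o) (z : K^o).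

(** The derivation rules are needed over [R[i]], with [R[i]^o] as source and
    target. Stating them over an abstract field keeps the conversion between
    the various normed module structures on [R[i]] out of their uses. *)
Lemma derivable_mul f g z : derivable f z 1 -> derivable g z 1 ->
  derivable (fun w => f w * g w : K^o) z 1.
Proof. exact: derivableM. Qed.

Lemma derivable_inv f z : f z != 0 -> derivable f z 1 ->
  derivable (fun w => (f w)^-1 : K^o) z 1.
Proof. exact: derivableV. Qed.

Lemma derivable_affine f (a b : K) z : derivable f z 1 ->
  derivable (fun w => a * f w + b : K^o) z 1.
Proof.
move=> df; apply: (@derivableD _ _ _ (a \*: f) (cst (b : K^o))); last exact: derivable_cst.
exact: derivableZ.
Qed.

Lemma derivable_pow f n z : derivable f z 1 -> derivable (fun w => f w ^+ n : K^o) z 1.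
Proof.
move=> df; elim: n => [|n IH]; first exact: (derivable_cst (1 : K^o)).
have := derivable_mul df IH; congr (derivable _ z 1).
by apply/funext => w; rewrite exprS.
Qed.

Lemma derivable_chord f (a m z0 : K) z : z != z0 -> derivable f z 1 ->
  derivable (fun w => (a * f w - m) * (w - z0)^-1 : K^o) z 1.
Proof.
move=> zz0 df; apply: derivable_mul; first exact: derivable_affine.
apply: derivable_inv; first by rewrite subr_eq0.
by apply: (@derivableB _ _ _ id (cst (z0 : K^o))); [exact: derivable_id|exact: derivable_cst].
Qed.

Lemma derivable_peak (a b : K) z n : 1 - b * z != 0 ->
  derivable (fun w : K^o => a * (w * (1 - b * w)^-1) ^+ n : K^o) z 1.
Proof.
move=> nz; have did : derivable (id : K^o -> K^o) z 1 by exact: derivable_id.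
have daff := @derivable_affine id (- b) 1 z did.
have eq_aff : (fun w : K^o => - b * w + 1 : K^o) = (fun w => 1 - b * w).
  by apply/funext => w; rewrite mulNr addrC.
rewrite /= in daff; rewrite eq_aff in daff.
have dinv := @derivable_inv (fun w : K^o => 1 - b * w) z nz daff.
have dpow := @derivable_pow _ n z (@derivable_mul id _ z did dinv).
have := @derivable_affine _ a 0 z dpow; congr (derivable _ z 1).
by apply/funext => w; rewrite addr0.
Qed.

End field_derivatives.

(** * Goursat's theorem for closed forms on rectangles *)

Section segment_integral.
Context {R : realType}.
Implicit Types (h : R -> R) (a b c : R).

Definition seg h a b : R := \int[@lebesgue_measure R]_(x in `[a, b]) h x.

Lemma seg_integrable h a b : {in `[a, b], continuous h} ->
  (@lebesgue_measure R).-integrable `[a, b] (EFin \o h).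
Proof.
move=> ch; apply: continuous_compact_integrable; first exact: segment_compact.
by apply: continuous_in_subspaceT => x /set_mem; exact: ch.
Qed.

Lemma seg_split h a c b : a <= c -> c <= b -> {in `[a, b], continuous h} ->
  seg h a b = seg h a c + seg h c b.
Proof.
move=> ac cb ch; have ih := seg_integrable ch.
have := @Rintegral_itvB _ h (BLeft a) (BRight b) c ih.
rewrite !bnd_simp => /(_ ac cb) E.
rewrite /seg -[X in _ + X]Rintegral_itv_obnd_cbnd.
  by rewrite -E addrC subrK.
by apply: integrableS ih => //; apply: subset_itvr; rewrite bnd_simp.
Qed.

Lemma segB h g a b : {in `[a, b], continuous h} -> {in `[a, b], continuous g} ->
  seg h a b - seg g a b = seg (h \- g) a b.
Proof. by move=> ch cg; rewrite /seg RintegralB//; exact: seg_integrable. Qed.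

Lemma seg_cst k a b : a <= b -> seg (cst k) a b = k * (b - a).
Proof.
move=> ab; rewrite /seg Rintegral_cst//.
have -> : fine (lebesgue_measure `[a, b]%classic) = b - a; last by [].
rewrite lebesgue_measure_itv/= lte_fin.
by case: ltgtP ab => //= -> _; rewrite subrr.
Qed.

Lemma seg_le h g a b : {in `[a, b], continuous h} -> {in `[a, b], continuous g} ->
  (forall x, a <= x <= b -> h x <= g x) -> seg h a b <= seg g a b.
Proof.
by move=> ch cg hg; apply: le_Rintegral => //; exact: seg_integrable.
Qed.

Lemma seg_close h k e a b : a <= b -> {in `[a, b], continuous h} ->
  (forall x, a <= x <= b -> `|h x - k| <= e) -> `|seg h a b - k * (b - a)| <= e * (b - a).
Proof.
move=> ab ch hk; have cc (l : R) : {in `[a, b], continuous (cst l : R -> R)}.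
  by move=> x _; exact: cst_continuous.
have H1 : seg h a b <= (k + e) * (b - a).
  rewrite -seg_cst//; apply: seg_le => // x /hk; rewrite ler_distl => /andP[_].
  by rewrite addrC.
have H2 : (k - e) * (b - a) <= seg h a b.
  by rewrite -seg_cst//; apply: seg_le => // x /hk; rewrite ler_distl => /andP[].
by rewrite ler_distl; apply/andP; split; nra.
Qed.

Lemma seg_bound h M a b : a <= b -> {in `[a, b], continuous h} ->
  (forall x, a <= x <= b -> `|h x| <= M) -> `|seg h a b| <= M * (b - a).
Proof.
move=> ab ch hM; have := @seg_close h 0 M a b ab ch; rewrite mul0r subr0; apply.
by move=> x /hM; rewrite subr0.
Qed.

End segment_integral.

Section distances.
Context {R : realType}.
Implicit Types (x y a b c e s t u v : R).

Lemma ler_dist_itv x y a b : a <= x <= b -> a <= y <= b -> `|x - y| <= b - a.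
Proof.
by move=> /andP[? ?] /andP[? ?]; rewrite ler_norml; apply/andP; split; lra.
Qed.

Lemma ler_dist_sub u v c a b e s :
  `|u - c - a| <= e / 2 * s -> `|v - c - b| <= e / 2 * s -> `|(u - v) - (a - b)| <= e * s.
Proof.
move=> ua vb; have -> : (u - v) - (a - b) = (u - c - a) - (v - c - b) by ring.
by apply: le_trans (ler_normB _ _) _; lra.
Qed.

Lemma ler_norm_add4 s t u v e : `|s| <= e / 4 -> `|t| <= e / 4 -> `|u| <= e / 4 ->
  `|v| <= e / 4 -> `|(s + t) + (u + v)| <= e.
Proof.
move=> ? ? ? ?; apply: le_trans (ler_normD _ _) _.
by have := ler_normD s t; have := ler_normD u v; lra.
Qed.

End distances.

Section goursat.
Context {R : realType}.
Implicit Types (P Q : R -> R -> R) (x y a b c d e k m u v w z M : R).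

(** The counterclockwise integral of the form [P dx + Q dy] along the boundary
    of the rectangle. *)
Definition circulation P Q x0 x1 y0 y1 : R :=
  (seg (P ^~ y0) x0 x1 - seg (P ^~ y1) x0 x1) + (seg (Q x1) y0 y1 - seg (Q x0) y0 y1).

(** Differentiability of [P] and [Q] at one point, with [P_y = Q_x] there: the
    number [b] is the common value. Nothing is asked of the partial derivatives
    as functions of the point, so that this follows from complex
    differentiability alone. *)
Definition closed_at P Q x y : Prop := exists a b c : R,
  forall e, 0 < e -> exists2 d, 0 < d & forall x' y', `|x' - x| < d -> `|y' - y| < d ->
   `|P x' y' - P x y - (a * (x' - x) + b * (y' - y))| <= e * (`|x' - x| + `|y' - y|) /\
   `|Q x' y' - Q x y - (b * (x' - x) + c * (y' - y))| <= e * (`|x' - x| + `|y' - y|).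

Lemma lip_continuous (h : R -> R) x (k d : R) : 0 < d ->
  (forall x', `|x' - x| < d -> `|h x' - h x| <= k * `|x' - x|) -> {for x, continuous h}.
Proof.
move=> d0 H; apply/cvgrPdist_lt => e e0.
have [k0|k0] := lerP k 0.
  near=> y; rewrite distrC; have yd : `|y - x| < d.
    by rewrite distrC; near: y; apply: cvgr_dist_lt.
  apply: le_lt_trans (H _ yd) _; apply: le_lt_trans e0.
  by apply: mulr_le0_ge0.
near=> y; rewrite distrC.
have yd : `|y - x| < d by rewrite distrC; near: y; apply: cvgr_dist_lt.
apply: le_lt_trans (H _ yd) _; rewrite mulrC -ltr_pdivlMr//.
by rewrite distrC; near: y; apply: cvgr_dist_lt => //; rewrite divr_gt0.
Unshelve. all: by end_near. Qed.

Lemma closed_at_continuous P Q x y : closed_at P Q x y ->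
  [/\ {for x, continuous (P ^~ y)}, {for y, continuous (P x)},
   {for x, continuous (Q ^~ y)} & {for y, continuous (Q x)}].
Proof.
move=> [a [b [c /(_ 1 ltr01)[d d0 H]]]].
split; [apply: (@lip_continuous _ _ (1 + `|a|) d) => //
       |apply: (@lip_continuous _ _ (1 + `|b|) d) => //
       |apply: (@lip_continuous _ _ (1 + `|b|) d) => //
       |apply: (@lip_continuous _ _ (1 + `|c|) d) => //] => z zd.
- have [+ _] := H z y zd ltac:(by rewrite subrr normr0).
  rewrite subrr normr0 mulr0 !addr0 mul1r mulrDl mul1r -normrM.
  move=> h; rewrite -[X in `|X|](subrK (a * (z - x))); apply: le_trans (ler_normD _ _) _.
  by rewrite lerD2r.
- have [+ _] := H x z ltac:(by rewrite subrr normr0) zd.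
  rewrite subrr normr0 mulr0 !add0r mul1r mulrDl mul1r -normrM.
  move=> h; rewrite -[X in `|X|](subrK (b * (z - y))); apply: le_trans (ler_normD _ _) _.
  by rewrite lerD2r.
- have [_] := H z y zd ltac:(by rewrite subrr normr0).
  rewrite subrr normr0 mulr0 !addr0 mul1r mulrDl mul1r -normrM.
  move=> h; rewrite -[X in `|X|](subrK (b * (z - x))); apply: le_trans (ler_normD _ _) _.
  by rewrite lerD2r.
- have [_] := H x z ltac:(by rewrite subrr normr0) zd.
  rewrite subrr normr0 mulr0 !add0r mul1r mulrDl mul1r -normrM.
  move=> h; rewrite -[X in `|X|](subrK (c * (z - y))); apply: le_trans (ler_normD _ _) _.
  by rewrite lerD2r.
Qed.

Definition closed_on P Q x0 x1 y0 y1 : Prop := forall x y,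
  x0 <= x <= x1 -> y0 <= y <= y1 -> closed_at P Q x y.

Lemma closed_on_continuous P Q x0 x1 y0 y1 x y : closed_on P Q x0 x1 y0 y1 ->
  x0 <= x <= x1 -> y0 <= y <= y1 ->
  [/\ {in `[x0, x1], continuous (P ^~ y)}, {in `[y0, y1], continuous (P x)},
   {in `[x0, x1], continuous (Q ^~ y)} & {in `[y0, y1], continuous (Q x)}].
Proof.
move=> cl xx yy.
by split => z; rewrite in_itv/= => zz;
  [have [] := closed_at_continuous (cl z y zz yy)|have [] := closed_at_continuous (cl x z xx zz)
  |have [] := closed_at_continuous (cl z y zz yy)|have [] := closed_at_continuous (cl x z xx zz)].
Qed.

Lemma circulation_splitx P Q x0 m x1 y0 y1 : x0 <= m -> m <= x1 ->
  {in `[x0, x1], continuous (P ^~ y0)} -> {in `[x0, x1], continuous (P ^~ y1)} ->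
  circulation P Q x0 x1 y0 y1 = circulation P Q x0 m y0 y1 + circulation P Q m x1 y0 y1.
Proof.
move=> xm mx c0 c1.
by rewrite /circulation (seg_split xm mx c0) (seg_split xm mx c1); ring.
Qed.

Lemma circulation_splity P Q x0 x1 y0 m y1 : y0 <= m -> m <= y1 ->
  {in `[y0, y1], continuous (Q x0)} -> {in `[y0, y1], continuous (Q x1)} ->
  circulation P Q x0 x1 y0 y1 = circulation P Q x0 x1 y0 m + circulation P Q x0 x1 m y1.
Proof.
move=> ym my c0 c1.
by rewrite /circulation (seg_split ym my c0) (seg_split ym my c1); ring.
Qed.

Lemma closed_onS P Q x0 x1 y0 y1 x0' x1' y0' y1' :
  closed_on P Q x0 x1 y0 y1 -> x0 <= x0' -> x1' <= x1 -> y0 <= y0' -> y1' <= y1 ->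
  closed_on P Q x0' x1' y0' y1'.
Proof.
move=> cl a b c d x y /andP[x1x x2] /andP[y1y y2]; apply: cl.
  by rewrite (le_trans a x1x) (le_trans x2 b).
by rewrite (le_trans c y1y) (le_trans y2 d).
Qed.

(** To first order at the point the form is affine and, since the two cross
    derivatives agree, the contributions of opposite sides cancel exactly. Only
    the remainders are left, of size at most [e / 2] times the half perimeter on
    sides whose total length is the perimeter. *)
Lemma circulation_small P Q x y e : closed_at P Q x y -> 0 < e ->
  exists2 d, 0 < d & forall x0 x1 y0 y1, x0 <= x <= x1 -> y0 <= y <= y1 ->
    closed_on P Q x0 x1 y0 y1 -> x1 - x0 < d -> y1 - y0 < d ->
    `|circulation P Q x0 x1 y0 y1| <= e * ((x1 - x0) + (y1 - y0)) ^+ 2.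
Proof.
move=> [a [b [c H]]] e0; have [|d d0 {}H] := H (e / 2); first by rewrite divr_gt0.
exists d => // x0 x1 y0 y1 /andP[x0x xx1] /andP[y0y yy1] cl xd yd.
have x01 := le_trans x0x xx1; have y01 := le_trans y0y yy1.
set s := (x1 - x0) + (y1 - y0).
have in_x x' : x0 <= x' <= x1 -> `|x' - x| <= x1 - x0.
  by move=> xx'; apply: ler_dist_itv => //; rewrite x0x.
have in_y y' : y0 <= y' <= y1 -> `|y' - y| <= y1 - y0.
  by move=> yy'; apply: ler_dist_itv => //; rewrite y0y.
have H' x' y' : x0 <= x' <= x1 -> y0 <= y' <= y1 ->
   `|P x' y' - P x y - (a * (x' - x) + b * (y' - y))| <= e / 2 * s /\
   `|Q x' y' - Q x y - (b * (x' - x) + c * (y' - y))| <= e / 2 * s.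
  move=> /in_x xx' /in_y yy'.
  have [HP HQ] := H x' y' (le_lt_trans xx' xd) (le_lt_trans yy' yd).
  have le_s : e / 2 * (`|x' - x| + `|y' - y|) <= e / 2 * s.
    by rewrite ler_pM2l ?divr_gt0// lerD.
  by split; [exact: le_trans HP _|exact: le_trans HQ _].
have xx0 : x0 <= x0 <= x1 by rewrite lexx.
have xx1' : x0 <= x1 <= x1 by rewrite lexx andbT.
have yy0 : y0 <= y0 <= y1 by rewrite lexx.
have yy1' : y0 <= y1 <= y1 by rewrite lexx andbT.
have [cP0 _ _ cQ0] := closed_on_continuous cl xx0 yy0.
have [cP1 _ _ cQ1] := closed_on_continuous cl xx1' yy1'.
rewrite /circulation !segB//.
set A := seg _ _ _; set B := seg _ _ _.
have HA : `|A - (b * (y0 - y1)) * (x1 - x0)| <= (e * s) * (x1 - x0).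
  apply: seg_close => // [z zz|z zz].
    by apply: continuousB; [exact: cP0|exact: cP1].
  have [h0 _] := H' z y0 zz yy0; have [h1 _] := H' z y1 zz yy1'.
  have -> : b * (y0 - y1) = (a * (z - x) + b * (y0 - y)) - (a * (z - x) + b * (y1 - y)) by ring.
  exact: ler_dist_sub h0 h1.
have HB : `|B - (b * (x1 - x0)) * (y1 - y0)| <= (e * s) * (y1 - y0).
  apply: seg_close => // [z zz|z zz].
    by apply: continuousB; [exact: cQ1|exact: cQ0].
  have [_ h0] := H' x0 z xx0 zz; have [_ h1] := H' x1 z xx1' zz.
  have -> : b * (x1 - x0) = (b * (x1 - x) + c * (z - y)) - (b * (x0 - x) + c * (z - y)) by ring.
  exact: ler_dist_sub h1 h0.
have -> : A + B = (A - b * (y0 - y1) * (x1 - x0)) + (B - b * (x1 - x0) * (y1 - y0)) by ring.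
apply: le_trans (ler_normD _ _) _; apply: le_trans (lerD HA HB) _.
by rewrite -mulrDr -/s expr2 mulrA.
Qed.

Lemma nested_intervals (u v : R ^nat) : nondecreasing_seq u -> nonincreasing_seq v ->
  (forall n, u n <= v n) -> exists x, forall n, u n <= x <= v n.
Proof.
move=> iu dv uv; have uvmn (m n : nat) : u m <= v n.
  apply: le_trans (iu _ _ (leq_maxl m n)) _.
  by apply: le_trans (uv _) _; exact: dv (leq_maxr m n).
exists (sup (range u)) => n; apply/andP; split.
  apply: ub_le_sup; last by exists n.
  by exists (v 0%N) => _ [m _ <-].
apply: ge_sup; first by exists (u 0%N), 0%N.
by move=> _ [m _ <-].
Qed.

(** Goursat's bisection. The bound [e * (half perimeter) ^+ 2] is divided by
    exactly 4 when the sides are halved, so if it fails on a rectangle it fails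
    on one of the four quarters. Iterating, it fails on rectangles that shrink
    to a point, against [circulation_small]. *)
Theorem circulation_eq0 P Q x0 x1 y0 y1 : x0 <= x1 -> y0 <= y1 ->
  closed_on P Q x0 x1 y0 y1 -> circulation P Q x0 x1 y0 y1 = 0.
Proof.
move=> x01 y01 cl; apply/eqP; rewrite -normr_le0; apply/ler_addgt0Pl => e' e'0.
rewrite addr0.
have [e e0 le_e] : exists2 e, 0 < e & e * ((x1 - x0) + (y1 - y0)) ^+ 2 <= e'.
  exists (e' / (1 + ((x1 - x0) + (y1 - y0)) ^+ 2)).
    by rewrite divr_gt0// ltr_pwDl// sqr_ge0.
  rewrite mulrAC ler_pdivrMr; last by rewrite ltr_pwDl// sqr_ge0.
  by rewrite ler_pM2l// lerDr.
apply: le_trans le_e; rewrite leNgt; apply/negP => bad0.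
pose bad (q : (R * R) * (R * R)) := [/\ q.1.1 <= q.1.2, q.2.1 <= q.2.2,
  closed_on P Q q.1.1 q.1.2 q.2.1 q.2.2 &
  e * ((q.1.2 - q.1.1) + (q.2.2 - q.2.1)) ^+ 2 <
  `|circulation P Q q.1.1 q.1.2 q.2.1 q.2.2|].
pose half (s t : R * R) := [/\ s.1 <= t.1, t.2 <= s.2 & t.2 - t.1 = (s.2 - s.1) / 2].
pose next q q' := bad q -> [/\ bad q', half q.1 q'.1 & half q.2 q'.2].
have ex_next q : {q' | next q q'}.
  apply: cid; have [[bx bY bcl b]|nb] := pselect (bad q); last by exists q.
  case: q => [[a0 a1] [b0 b1]] /= in bx bY bcl b *.
  pose am := (a0 + a1) / 2; pose bm := (b0 + b1) / 2.
  have [am0 am1] : a0 <= am /\ am <= a1 by rewrite /am; lra.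
  have [bm0 bm1] : b0 <= bm /\ bm <= b1 by rewrite /bm; lra.
  have cl4 c0 c1 d0 d1 := @closed_onS _ _ _ _ _ _ c0 c1 d0 d1 bcl.
  have in_a c : a0 <= c -> c <= a1 -> a0 <= c <= a1 by move=> ? ?; apply/andP.
  have in_b c : b0 <= c -> c <= b1 -> b0 <= c <= b1 by move=> ? ?; apply/andP.
  have [cP0 _ _ cQ0] := closed_on_continuous bcl (in_a _ (lexx _) bx) (in_b _ (lexx _) bY).
  have [cP1 _ _ cQ1] := closed_on_continuous bcl (in_a _ bx (lexx _)) (in_b _ bY (lexx _)).
  have [_ _ _ cQm] := closed_on_continuous bcl (in_a _ am0 am1) (in_b _ bm0 bm1).
  have [[q' []]|] := pselect (exists q', [/\ bad q', half (a0, a1) q'.1 & half (b0, b1) q'.2]).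
    by move=> ? ? ?; exists q'.
  move=> /forallNP no; exfalso.
  have child c0 c1 d0 d1 : half (a0, a1) (c0, c1) -> half (b0, b1) (d0, d1) ->
      `|circulation P Q c0 c1 d0 d1| <= e * ((a1 - a0) + (b1 - b0)) ^+ 2 / 4.
    move=> hc hd; rewrite leNgt; apply/negP => lt_c; apply: (no ((c0, c1), (d0, d1))).
    move: (hc) (hd) => [/= c1' c2' c3'] [/= d1' d2' d3']; split => //; split => /=.
    - by rewrite -subr_ge0 c3' divr_ge0 ?subr_ge0.
    - by rewrite -subr_ge0 d3' divr_ge0 ?subr_ge0.
    - exact: cl4.
    - by apply: le_lt_trans lt_c; rewrite c3' d3' le_eqVlt; apply/orP; left; apply/eqP; field.
  move: b; rewrite (@circulation_splitx P Q _ _ _ _ _ am0 am1 cP0 cP1).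
  rewrite (@circulation_splity P Q _ _ _ _ _ bm0 bm1 cQ0 cQm).
  rewrite (@circulation_splity P Q _ _ _ _ _ bm0 bm1 cQm cQ1).
  rewrite ltNge => /negP; apply.
  have ha0 : half (a0, a1) (a0, am) by split => //=; rewrite /am; lra.
  have ha1 : half (a0, a1) (am, a1) by split => //=; rewrite /am; lra.
  have hb0 : half (b0, b1) (b0, bm) by split => //=; rewrite /bm; lra.
  have hb1 : half (b0, b1) (bm, b1) by split => //=; rewrite /bm; lra.
  by apply: ler_norm_add4; exact: child.
have [r [r0 rS]] := dependent_choice ex_next ((x0, x1), (y0, y1)).
have badr n : bad (r n) by elim: n => [|n IH]; [rewrite r0|have [] := rS n IH].
have hx n : half (r n).1 (r n.+1).1 by have [] := rS n (badr n).
have hy n : half (r n).2 (r n.+1).2 by have [] := rS n (badr n).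
have [x xP] : exists x, forall n, (r n).1.1 <= x <= (r n).1.2.
  apply: nested_intervals; last by move=> n; case: (badr n).
    by apply/nondecreasing_seqP => n; case: (hx n).
  by apply/nonincreasing_seqP => n; case: (hx n).
have [y yP] : exists y, forall n, (r n).2.1 <= y <= (r n).2.2.
  apply: nested_intervals; last by move=> n; case: (badr n).
    by apply/nondecreasing_seqP => n; case: (hy n).
  by apply/nonincreasing_seqP => n; case: (hy n).
have clxy : closed_at P Q x y by have := xP 0%N; have := yP 0%N; rewrite r0 => *; exact: cl.
have [d d0 small] := circulation_small clxy e0.
have wx n : (r n).1.2 - (r n).1.1 = (x1 - x0) / 2 ^+ n.
  elim: n => [|n IH]; first by rewrite r0 expr0 divr1.
  by have [_ _ ->] := hx n; rewrite IH exprS; field; rewrite expf_neq0.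
have wy n : (r n).2.2 - (r n).2.1 = (y1 - y0) / 2 ^+ n.
  elim: n => [|n IH]; first by rewrite r0 expr0 divr1.
  by have [_ _ ->] := hy n; rewrite IH exprS; field; rewrite expf_neq0.
have lt_d (w : R) : 0 <= w -> \forall n \near \oo, w / 2 ^+ n < d.
  move=> w0; have : w / 2 ^+ n @[n --> \oo] --> (0 : R).
    rewrite -[X in _ --> X](mulr0 w); apply: cvgMr.
    rewrite (_ : (fun n => (2 ^+ n)^-1) = (fun n => 2^-1 ^+ n)); last first.
      by apply/funext => n; rewrite exprVn.
    by apply: cvg_expr; rewrite ger0_norm// invf_lt1// ltr1n.
  by move=> /cvgrPdist_lt /(_ _ d0); apply: filterS => n; rewrite sub0r normrN;
     exact: le_lt_trans (ler_norm _).
have [n [nx ny]] : exists n, (x1 - x0) / 2 ^+ n < d /\ (y1 - y0) / 2 ^+ n < d.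
  have := filterI (lt_d (x1 - x0) _) (lt_d (y1 - y0) _).
  rewrite !subr_ge0 => /(_ _ x01 y01) [n _ /(_ n (leqnn _))[? ?]]; by exists n.
have [_ _ cln] := badr n; rewrite ltNge => /negP; apply.
by apply: small => //; rewrite ?wx ?wy.
Qed.

End goursat.

Section puncture.
Context {R : realType}.
Implicit Types (P Q : R -> R -> R) (x y a b c d e k m u v w z M : R).

(** A singularity near which the form stays bounded does not matter: four
    strips around a small square about the singular point do not contain it,
    so the circulation is that of the square, which is at most a bound of the
    form times a perimeter that tends to 0. *)
Lemma circulation_puncture P Q x0 x1 y0 y1 a b M d : x0 < a < x1 -> y0 < b < y1 ->
  (forall x y, x0 <= x <= x1 -> y0 <= y <= y1 -> (x, y) != (a, b) -> closed_at P Q x y) ->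
  0 < d -> (forall x y, `|x - a| < d -> `|y - b| < d -> `|P x y| <= M /\ `|Q x y| <= M) ->
  circulation P Q x0 x1 y0 y1 = 0.
Proof.
move=> /andP[x0a ax1] /andP[y0b by1] cl d0 bnd.
have M0 : 0 <= M.
  by have [+ _] := bnd a b ltac:(by rewrite subrr normr0) ltac:(by rewrite subrr normr0);
     exact: le_trans.
(* 8 * M * k is M times the perimeter of the square of half side k. *)
have shrink k : 0 < k -> k < d -> k <= a - x0 -> k <= x1 - a -> k <= b - y0 -> k <= y1 - b ->
    `|circulation P Q x0 x1 y0 y1| <= 8 * M * k.
  move=> k0 kd kx0 kx1 ky0 ky1.
  have [xm0 xm1] : x0 <= a - k /\ a + k <= x1 by lra.
  have [ym0 ym1] : y0 <= b - k /\ b + k <= y1 by lra.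
  have [aL aR] : a - k < a /\ a < a + k by lra.
  have [bL bR] : b - k < b /\ b < b + k by lra.
  have x0_ak : x0 <= a + k by exact: le_trans xm0 (ltW (lt_trans aL aR)).
  have ak_x1 : a - k <= x1 by exact: le_trans (ltW (lt_trans aL aR)) xm1.
  have y0_bk : y0 <= b + k by exact: le_trans ym0 (ltW (lt_trans bL bR)).
  have bk_y1 : b - k <= y1 by exact: le_trans (ltW (lt_trans bL bR)) ym1.
  have y01 : y0 <= y1 by exact: ltW (lt_trans y0b by1).
  have x01 : x0 <= x1 by exact: ltW (lt_trans x0a ax1).
  have contP y : y0 <= y <= y1 -> y != b -> {in `[x0, x1], continuous (P ^~ y)}.
    move=> yy yb x; rewrite in_itv/= => xx.
    by have [|] := closed_at_continuous (cl x y xx yy _) => //; rewrite xpair_eqE negb_and yb orbT.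
  have contQ x : x0 <= x <= x1 -> x != a -> {in `[y0, y1], continuous (Q x)}.
    move=> xx xa y; rewrite in_itv/= => yy.
    by have [|] := closed_at_continuous (cl x y xx yy _) => //; rewrite xpair_eqE negb_and xa.
  have cP0 : {in `[x0, x1], continuous (P ^~ y0)}.
    by apply: contP; rewrite ?lexx ?lt_eqF.
  have cP1 : {in `[x0, x1], continuous (P ^~ y1)}.
    by apply: contP; rewrite ?lexx ?andbT ?gt_eqF.
  have cPl : {in `[x0, x1], continuous (P ^~ (b - k))}.
    by apply: contP; rewrite ?ym0 ?lt_eqF.
  have cPr : {in `[x0, x1], continuous (P ^~ (b + k))}.
    by apply: contP; rewrite ?y0_bk ?gt_eqF.
  have cQl : {in `[y0, y1], continuous (Q (a - k))}.
    by apply: contQ; rewrite ?xm0 ?lt_eqF.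
  have cQr : {in `[y0, y1], continuous (Q (a + k))}.
    by apply: contQ; rewrite ?x0_ak ?gt_eqF.
  have sub (h : R -> R) s t s' t' : {in `[s, t], continuous h} -> s <= s' -> t' <= t ->
      {in `[s', t'], continuous h}.
    move=> ch ss tt u; rewrite in_itv/= => /andP[su ut]; apply: ch.
    by rewrite in_itv/= (le_trans ss su) (le_trans ut tt).
  have off u0 u1 v0 v1 : x0 <= u0 -> u1 <= x1 -> y0 <= v0 -> v1 <= y1 ->
      (u0 > a) || (u1 < a) || (v0 > b) || (v1 < b) -> u0 <= u1 -> v0 <= v1 ->
      circulation P Q u0 u1 v0 v1 = 0.
    move=> xu ux yv vy h u01 v01; apply: circulation_eq0 => // x y /andP[ux' xu'] /andP[vy' yv'].
    apply: cl.
    - by rewrite (le_trans xu ux') (le_trans xu' ux).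
    - by rewrite (le_trans yv vy') (le_trans yv' vy).
    - apply: contraTneq h => -[<- <-]; rewrite !negb_or -!leNgt.
      by rewrite ux' xu' vy' yv'.
  have ak : a - k <= a + k by exact: ltW (lt_trans aL aR).
  have bk : b - k <= b + k by exact: ltW (lt_trans bL bR).
  have -> : circulation P Q x0 x1 y0 y1 = circulation P Q (a - k) (a + k) (b - k) (b + k).
    rewrite (@circulation_splitx _ P Q x0 (a - k))//.
    rewrite (off x0 (a - k) y0 y1) ?aL ?orbT ?add0r//.
    rewrite (@circulation_splitx _ P Q (a - k) (a + k))//; last 2 first.
    - exact: sub cP0 _ _.
    - exact: sub cP1 _ _.
    rewrite (off (a + k) x1 y0 y1) ?aR ?addr0//.
    rewrite (@circulation_splity _ P Q _ _ y0 (b - k))//.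
    rewrite (off (a - k) (a + k) y0 (b - k)) ?bL ?orbT ?add0r//.
    rewrite (@circulation_splity _ P Q _ _ (b - k) (b + k))//; last 2 first.
    - exact: sub cQl _ _.
    - exact: sub cQr _ _.
    by rewrite (off (a - k) (a + k) (b + k) y1) ?bR ?orbT ?addr0.
  have near_a u : a - k <= u <= a + k -> `|u - a| < d.
    by rewrite -ler_distl => /le_lt_trans; apply.
  have near_b v : b - k <= v <= b + k -> `|v - b| < d.
    by rewrite -ler_distl => /le_lt_trans; apply.
  have in_a u : u = a - k \/ u = a + k -> a - k <= u <= a + k.
    by case=> ->; rewrite lexx ?andbT.
  have in_b v : v = b - k \/ v = b + k -> b - k <= v <= b + k.
    by case=> ->; rewrite lexx ?andbT.
  have lenE c : M * ((c + k) - (c - k)) = 8 * M * k / 4 by field.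
  have boundP y : y = b - k \/ y = b + k -> {in `[x0, x1], continuous (P ^~ y)} ->
      `|seg (P ^~ y) (a - k) (a + k)| <= 8 * M * k / 4.
    move=> yE cPy; rewrite -(lenE a); apply: seg_bound => // [|x xx]; first exact: sub cPy _ _.
    by have [] := bnd x y (near_a _ xx) (near_b _ (in_b _ yE)).
  have boundQ x : x = a - k \/ x = a + k -> {in `[y0, y1], continuous (Q x)} ->
      `|seg (Q x) (b - k) (b + k)| <= 8 * M * k / 4.
    move=> xE cQx; rewrite -(lenE b); apply: seg_bound => // [|y yy]; first exact: sub cQx _ _.
    by have [] := bnd x y (near_a _ (in_a _ xE)) (near_b _ yy).
  rewrite /circulation; apply: ler_norm_add4; rewrite ?normrN.
  - by apply: boundP => //; left.
  - by apply: boundP => //; right.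
  - by apply: boundQ => //; right.
  - by apply: boundQ => //; left.
apply/eqP; rewrite -normr_le0; apply/ler_addgt0Pl => e e0; rewrite addr0.
pose k := Num.min (Num.min (d / 2) (e / (8 * M + 1)))
  (Num.min (Num.min (a - x0) (x1 - a)) (Num.min (b - y0) (y1 - b))).
have M1 : 0 < 8 * M + 1 by rewrite ltr_wpDl// mulr_ge0.
have k0 : 0 < k by rewrite !lt_min !subr_gt0 x0a ax1 y0b by1 !divr_gt0.
have : k <= k by []. rewrite {2}/k !le_min => /andP[/andP[kd ke] /andP[/andP[? ?] /andP[? ?]]].
apply: le_trans (shrink k _ _ _ _ _ _) _ => //; first lra.
move: ke; rewrite ler_pdivlMr// => ke; nra.
Qed.

End puncture.

(** * From complex derivatives to closed forms *)

Section complex_estimates.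
Context {R : realType}.
Local Notation C := (cplx R).
Implicit Types (z w : R[i]) (x y a b e d r : R).

Lemma Re_le_normc z : `|complex.Re z| <= normc z.
Proof.
by case: z => a b /=; rewrite -sqrtr_sqr ler_sqrt ?lerDl ?sqr_ge0// addr_ge0 ?sqr_ge0.
Qed.

Lemma Im_le_normc z : `|complex.Im z| <= normc z.
Proof.
by case: z => a b /=; rewrite -sqrtr_sqr ler_sqrt ?lerDr ?sqr_ge0// addr_ge0 ?sqr_ge0.
Qed.

Lemma normc_le_ReIm z : normc z <= `|complex.Re z| + `|complex.Im z|.
Proof.
case: z => a b /=; rewrite -[leRHS]ger0_norm ?addr_ge0// -sqrtr_sqr ler_sqrt ?sqr_ge0//.
by rewrite sqrrD !real_normK ?num_real// lerD2r lerDl mulrn_wge0// mulr_ge0.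
Qed.

Lemma normc_sqr z : normc z ^+ 2 = complex.Re z ^+ 2 + complex.Im z ^+ 2.
Proof. by case: z => a b /=; rewrite sqr_sqrtr// addr_ge0 ?sqr_ge0. Qed.

Lemma derivable_approx (g : C -> C) (z : C) : derivable g z 1 ->
  exists l : C, forall e : R, 0 < e -> exists2 d : R, 0 < d & forall w : C, normc (w - z) < d ->
    normc (g w - g z - l * (w - z)) <= e * normc (w - z).
Proof.
move=> /derivable_nbhs/eqaddoP H; exists ('D_1 g z) => e e0.
have /H : 0 < e%:C :> R[i] by rewrite ltcR.
move=> /nbhs_ballP[d /= d0 dH].
have d0' : 0 < complex.Re d by move: d0; rewrite ltcE => /andP[].
have dE : d = (complex.Re d)%:C by rewrite RRe_real// gtr0_real.
exists (complex.Re d) => // w wz.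
have := dH (w - z); rewrite /ball/= sub0r normrN normC_normc dE ltcR => /(_ wz).
rewrite !fctE /= /GRing.scale/= mulr1 subrK !normC_normc -rmorphM/= lecR.
by rewrite opprD addrA (mulrC (w - z)).
Qed.

(** The Cauchy-Riemann equations, read as closedness of
    [Im (g dz) = Im g dx + Re g dy]. *)
Lemma derivable_closed_at (g : C -> C) x y : derivable g (x +i* y) 1 ->
  closed_at (fun x y => complex.Im (g (x +i* y))) (fun x y => complex.Re (g (x +i* y))) x y.
Proof.
move=> /derivable_approx[[l1 l2] H]; exists l2, l1, (- l2) => e e0.
have [d d0 {}H] := H e e0; exists (d / 2); first by rewrite divr_gt0.
move=> x' y' xd yd.
set w : C := x' +i* y'; set z : C := x +i* y.
have wz : normc (w - z) <= `|x' - x| + `|y' - y| by exact: normc_le_ReIm.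
have wzd : normc (w - z) < d.
  by apply: le_lt_trans wz _; rewrite [ltRHS]splitr ltrD.
have := le_trans (H w wzd) (ler_wpM2l (ltW e0) wz).
set u := g w - _ - _ => hu.
split.
- apply: le_trans hu; apply: le_trans (Im_le_normc _); rewrite /u.
  case: (g w) (g z) => [a b] [a' b'] /=.
  by rewrite le_eqVlt; apply/orP; left; apply/eqP; congr (`| _ |); ring.
- apply: le_trans hu; apply: le_trans (Re_le_normc _); rewrite /u.
  case: (g w) (g z) => [a b] [a' b'] /=.
  by rewrite le_eqVlt; apply/orP; left; apply/eqP; congr (`| _ |); ring.
Qed.

End complex_estimates.

Section cauchy_rectangle.
Context {R : realType}.
Local Notation C := (cplx R).
Implicit Types (z w : R[i]) (x y a b e d r k : R).

Lemma seg_le_affine (h g : R -> R) k l a b : a <= b ->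
  {in `[a, b], continuous h} -> {in `[a, b], continuous g} ->
  (forall x, a <= x <= b -> h x <= k * g x - l) ->
  seg h a b <= k * seg g a b - l * (b - a).
Proof.
move=> ab ch cg hg; have ckg : {in `[a, b], continuous (fun x => k * g x)}.
  by move=> x xx; apply: cvgMr; exact: cg.
have cl : {in `[a, b], continuous (cst l : R -> R)} by move=> x _; exact: cst_continuous.
rewrite -seg_cst// -[X in X - _]RintegralZl//; last exact: seg_integrable.
rewrite [X in _ <= X](segB ckg cl); apply: seg_le => // x xx.
by apply: continuousB; [exact: ckg|exact: cl].
Qed.

Lemma segN (h : R -> R) a b : {in `[a, b], continuous h} ->
  - seg h a b = seg (fun x => - h x) a b.
Proof.
move=> ch; rewrite -mulN1r -RintegralZl//; last exact: seg_integrable.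
by apply: eq_Rintegral => x _; rewrite mulN1r.
Qed.

Lemma derivable_continuous_x (f : C -> C) x y : derivable f (x +i* y) 1 ->
  {for x, continuous (fun x => normc (f (x +i* y)))}.
Proof.
move=> /derivable_approx[l /(_ 1 ltr01)[d d0 H]].
apply: (@lip_continuous _ _ x (1 + normc l) d) => // x' xd.
apply: le_trans (normc_dist _ _) _; have := H (x' +i* y).
set w := x' +i* y; set z := x +i* y.
have -> : normc (w - z) = `|x' - x| by rewrite /= subrr expr0n addr0 sqrtr_sqr.
move=> /(_ xd); rewrite mul1r mulrDl mul1r => h.
rewrite -[X in normc X](subrK (l * (w - z))).
apply: le_trans (le_normcD _ _) _; rewrite normcM lerD//.
by rewrite /= subrr expr0n addr0 sqrtr_sqr.
Qed.

Lemma derivable_continuous_y (f : C -> C) x y : derivable f (x +i* y) 1 ->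
  {for y, continuous (fun y => normc (f (x +i* y)))}.
Proof.
move=> /derivable_approx[l /(_ 1 ltr01)[d d0 H]].
apply: (@lip_continuous _ _ y (1 + normc l) d) => // y' yd.
apply: le_trans (normc_dist _ _) _; have := H (x +i* y').
set w := x +i* y'; set z := x +i* y.
have nwz : normc (w - z) = `|y' - y| by rewrite /= subrr expr0n add0r sqrtr_sqr.
rewrite nwz => /(_ yd); rewrite mul1r mulrDl mul1r => h.
rewrite -[X in normc X](subrK (l * (w - z))).
by apply: le_trans (le_normcD _ _) _; rewrite normcM nwz lerD.
Qed.

(** On the sides of a rectangle about the origin, [Im (dz / z)] has the
    density [t / (u ^+ 2 + v ^+ 2)], where [t] is the distance to the line
    that carries the side. *)
Lemma ratio_lower_bound u v t r : 0 < r -> `|u| <= r -> `|v| <= r ->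
  r / 2 <= t -> t <= `|u| \/ t <= `|v| -> (4 * r)^-1 <= t / (u ^+ 2 + v ^+ 2).
Proof.
move=> r0 ur vr rt tuv.
have u2 : u ^+ 2 <= r ^+ 2 by rewrite -real_normK ?num_real// lerXn2r// ?nnegrE// ltW.
have v2 : v ^+ 2 <= r ^+ 2 by rewrite -real_normK ?num_real// lerXn2r// ?nnegrE// ltW.
have r2 : 0 < r / 2 by rewrite divr_gt0.
have D0 : 0 < u ^+ 2 + v ^+ 2.
  rewrite -(real_normK (num_real u)) -(real_normK (num_real v)).
  by case: tuv => h; [rewrite ltr_pwDl|rewrite ltr_wpDl]; rewrite ?exprn_ge0// exprn_gt0//;
    apply: lt_le_trans h; exact: lt_le_trans rt.
rewrite ler_pdivlMr// mulrC ler_pdivrMr ?mulr_gt0//; nra.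
Qed.

Definition modulus (f : C -> C) x y : R := normc (f (x +i* y)).

(** Let [lam] have modulus 1 and [lam * f z0 = |f z0|]. The difference quotient
    [(lam * f z - |f z0|) / (z - z0)] is bounded near [z0], so the imaginary
    part of its integral over the boundary vanishes by [circulation_puncture].
    This compares [|f z0|] times the integral of [Im (dz / (z - z0))], which
    is at least 1, with the integral of [f / (z - z0)], where
    [|z - z0| >= r / 2]. *)
Lemma cauchy_rectangle (f : C -> C) a b r x0 x1 y0 y1 : 0 < r ->
  a - r <= x0 <= a - r / 2 -> a + r / 2 <= x1 <= a + r ->
  b - r <= y0 <= b - r / 2 -> b + r / 2 <= y1 <= b + r ->
  (forall x y, `|x - a| <= r -> `|y - b| <= r -> derivable f (x +i* y) 1) ->
  normc (f (a +i* b)) <= 2 / r *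
    (seg (modulus f ^~ y0) x0 x1 + seg (modulus f ^~ y1) x0 x1 +
     seg (modulus f x1) y0 y1 + seg (modulus f x0) y0 y1).
Proof.
move=> r0 /andP[x0l x0u] /andP[x1l x1u] /andP[y0l y0u] /andP[y1l y1u] df; set F := modulus f.
have r2 : 0 < r / 2 by rewrite divr_gt0.
have x0a : x0 < a by apply: le_lt_trans x0u _; rewrite ltrBlDr ltrDl.
have ax1 : a < x1 by apply: lt_le_trans x1l; rewrite ltrDl.
have y0b : y0 < b by apply: le_lt_trans y0u _; rewrite ltrBlDr ltrDl.
have by1 : b < y1 by apply: lt_le_trans y1l; rewrite ltrDl.
have x01 : x0 <= x1 by exact: ltW (lt_trans x0a ax1).
have y01 : y0 <= y1 by exact: ltW (lt_trans y0b by1).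
have in_x x : x0 <= x <= x1 -> `|x - a| <= r.
  by move=> /andP[xl xu]; rewrite ler_distl (le_trans x0l xl) (le_trans xu x1u).
have in_y y : y0 <= y <= y1 -> `|y - b| <= r.
  by move=> /andP[yl yu]; rewrite ler_distl (le_trans y0l yl) (le_trans yu y1u).
have xx0 : x0 <= x0 <= x1 by rewrite lexx.
have xx1 : x0 <= x1 <= x1 by rewrite lexx andbT.
have yy0 : y0 <= y0 <= y1 by rewrite lexx.
have yy1 : y0 <= y1 <= y1 by rewrite lexx andbT.
have cFx y : y0 <= y <= y1 -> {in `[x0, x1], continuous (F ^~ y)}.
  by move=> yy x xx; apply: derivable_continuous_x; apply: df; [exact: in_x|exact: in_y].
have cFy x : x0 <= x <= x1 -> {in `[y0, y1], continuous (F x)}.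
  by move=> xx y yy; apply: derivable_continuous_y; apply: df; [exact: in_x|exact: in_y].
set z0 : C := a +i* b; set m := normc (f z0).
have [f0|fn0] := eqVneq (f z0) 0.
  rewrite /m f0 normc0; apply: mulr_ge0; first by rewrite divr_ge0// ltW.
  by rewrite !addr_ge0//; apply: Rintegral_ge0 => ? _; exact: normc_ge0.
have m0 : 0 < m by rewrite lt_neqAle normc_ge0 andbT eq_sym; apply: contra fn0 => /eqP/eq0_normc ->.
(* A rotation, so that the constant in the numerator of g is real. *)
pose lam : C := m%:C / f z0.
have nlam : normc lam = 1.
  by rewrite /lam normcM normcV /= expr0n addr0 sqrtr_sqr ger0_norm ?normc_ge0// divff// gt_eqF.
have lamf : lam * f z0 = m%:C by rewrite /lam mulfVK.
pose g : C -> C := fun z => (lam * f z - m%:C) * (z - z0)^-1.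
have dg x y : `|x - a| <= r -> `|y - b| <= r -> (x, y) != (a, b) -> derivable g (x +i* y) 1.
  move=> xr yr xy; apply: (@derivable_chord R[i] f); last exact: df.
  by rewrite /z0 eq_complex/=; move: xy; rewrite xpair_eqE.
pose P x y := complex.Im (g (x +i* y)); pose Q x y := complex.Re (g (x +i* y)).
have cl x y : x0 <= x <= x1 -> y0 <= y <= y1 -> (x, y) != (a, b) -> closed_at P Q x y.
  by move=> xx yy xy; apply: derivable_closed_at; apply: dg => //; [exact: in_x|exact: in_y].
have circ0 : circulation P Q x0 x1 y0 y1 = 0.
  have [l /(_ 1 ltr01)[d d0 H]] := derivable_approx (df a b
    ltac:(by rewrite subrr normr0 ltW) ltac:(by rewrite subrr normr0 ltW)).
  apply: (@circulation_puncture _ P Q x0 x1 y0 y1 a b (1 + normc l) (d / 2)) => //.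
  - by rewrite x0a.
  - by rewrite y0b.
  - by rewrite divr_gt0.
  move=> x y xd yd; set w : C := x +i* y.
  have gM : normc (g w) <= 1 + normc l.
    have [wz|wz] := eqVneq w z0.
      by rewrite /g wz subrr invr0 mulr0 normc0 addr_ge0// normc_ge0.
    have nw : 0 < normc (w - z0).
      by rewrite lt_neqAle normc_ge0 andbT eq_sym; apply: contra wz => /eqP/eq0_normc/eqP; rewrite subr_eq0.
    have wd : normc (w - z0) < d.
      by apply: le_lt_trans (normc_le_ReIm _) _; rewrite [ltRHS]splitr; apply: ltrD.
    rewrite /g normcM normcV ler_pdivrMr// -lamf -mulrBr normcM nlam mul1r mulrDl mul1r.
    rewrite -[X in normc X](subrK (l * (w - z0))).
    apply: le_trans (le_normcD _ _) _; rewrite normcM lerD//.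
    by have := H w wd; rewrite mul1r.
  by split; apply: le_trans gM; [exact: Im_le_normc|exact: Re_le_normc].
have side x y : `|x - a| <= r -> `|y - b| <= r -> r / 2 <= `|x - a| \/ r / 2 <= `|y - b| ->
  [/\ r / 2 <= x - a -> Q x y <= 2 / r * F x y - m / (4 * r),
      r / 2 <= a - x -> - Q x y <= 2 / r * F x y - m / (4 * r),
      r / 2 <= b - y -> P x y <= 2 / r * F x y - m / (4 * r) &
      r / 2 <= y - b -> - P x y <= 2 / r * F x y - m / (4 * r)].
  move=> xr yr far; set w : C := (x +i* y) - z0.
  have nw : r / 2 <= normc w.
    by case: far => /le_trans; apply; [exact: (Re_le_normc w)|exact: (Im_le_normc w)].
  have nw0 : 0 < normc w by apply: lt_le_trans nw; rewrite divr_gt0.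
  have qF : normc (lam * f (x +i* y) * w^-1) <= 2 / r * F x y.
    rewrite normcM normcV normcM nlam mul1r mulrC ler_wpM2r ?normc_ge0//.
    by rewrite -[2 / r]invf_div lef_pV2 ?posrE// divr_gt0.
  have gE : g (x +i* y) = lam * f (x +i* y) * w^-1 - m%:C * w^-1 by rewrite /g mulrBl.
  have PE : P x y = complex.Im (lam * f (x +i* y) * w^-1) + m * ((y - b) / ((x - a) ^+ 2 + (y - b) ^+ 2)).
    by rewrite /P gE raddfB /= mul0r addr0 !mulrN opprK.
  have QE : Q x y = complex.Re (lam * f (x +i* y) * w^-1) - m * ((x - a) / ((x - a) ^+ 2 + (y - b) ^+ 2)).
    by rewrite /Q gE raddfB /= mul0r subr0.
  have := le_trans (Im_le_normc _) qF; have := le_trans (Re_le_normc _) qF.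
  rewrite !ler_norml => /andP[q1 q2] /andP[q3 q4].
  have lb t : r / 2 <= t -> t <= `|x - a| \/ t <= `|y - b| ->
      m / (4 * r) <= m * (t / ((x - a) ^+ 2 + (y - b) ^+ 2)).
    by move=> rt tt; rewrite ler_pM2l//; exact: ratio_lower_bound.
  split=> h.
  - by have := lb _ h (or_introl (ler_norm _)); rewrite QE; lra.
  - have := lb _ h (or_introl _); rewrite distrC => /(_ (ler_norm _)).
    by rewrite -opprB mulNr mulrN QE; lra.
  - have := lb _ h (or_intror _); rewrite (distrC y) => /(_ (ler_norm _)).
    by rewrite -(opprB y b) mulNr mulrN PE; lra.
  - by have := lb _ h (or_intror (ler_norm _)); rewrite PE; lra.
have cP y : y0 <= y <= y1 -> y != b -> {in `[x0, x1], continuous (P ^~ y)}.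
  move=> yy yb x; rewrite in_itv/= => xx.
  by have [|] := closed_at_continuous (cl x y xx yy _) => //; rewrite xpair_eqE negb_and yb orbT.
have cQ x : x0 <= x <= x1 -> x != a -> {in `[y0, y1], continuous (Q x)}.
  move=> xx xa y; rewrite in_itv/= => yy.
  by have [|] := closed_at_continuous (cl x y xx yy _) => //; rewrite xpair_eqE negb_and xa.
have y0b' : y0 != b by rewrite lt_eqF.
have y1b' : y1 != b by rewrite gt_eqF.
have x0a' : x0 != a by rewrite lt_eqF.
have x1a' : x1 != a by rewrite gt_eqF.
have far t s : r / 2 <= t - s \/ r / 2 <= s - t -> r / 2 <= `|t - s|.
  by case=> /le_trans; apply; [|rewrite distrC]; exact: ler_norm.
have B0 : seg (P ^~ y0) x0 x1 <= 2 / r * seg (F ^~ y0) x0 x1 - m / (4 * r) * (x1 - x0).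
  apply: seg_le_affine => // [||x xx]; [exact: cP|exact: cFx|].
  have h : r / 2 <= b - y0 by rewrite lerBrDr addrC -lerBrDr.
  by have [_ _ + _] := side x y0 (in_x _ xx) (in_y _ yy0) (or_intror (far _ _ (or_intror h))); apply.
have B1 : - seg (P ^~ y1) x0 x1 <= 2 / r * seg (F ^~ y1) x0 x1 - m / (4 * r) * (x1 - x0).
  rewrite segN; last exact: cP.
  apply: seg_le_affine => // [x xx||x xx]; [by apply: cvgN; exact: cP|exact: cFx|].
  have h : r / 2 <= y1 - b by rewrite lerBrDl.
  by have [_ _ _] := side x y1 (in_x _ xx) (in_y _ yy1) (or_intror (far _ _ (or_introl h))); apply.
have B2 : seg (Q x1) y0 y1 <= 2 / r * seg (F x1) y0 y1 - m / (4 * r) * (y1 - y0).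
  apply: seg_le_affine => // [||y yy]; [exact: cQ|exact: cFy|].
  have h : r / 2 <= x1 - a by rewrite lerBrDl.
  by have [+ _ _ _] := side x1 y (in_x _ xx1) (in_y _ yy) (or_introl (far _ _ (or_introl h))); apply.
have B3 : - seg (Q x0) y0 y1 <= 2 / r * seg (F x0) y0 y1 - m / (4 * r) * (y1 - y0).
  rewrite segN; last exact: cQ.
  apply: seg_le_affine => // [y yy||y yy]; [by apply: cvgN; exact: cQ|exact: cFy|].
  have h : r / 2 <= a - x0 by rewrite lerBrDr addrC -lerBrDr.
  by have [_ + _ _] := side x0 y (in_x _ xx0) (in_y _ yy) (or_introl (far _ _ (or_intror h))); apply.
have perim : m <= m / (4 * r) * (2 * (x1 - x0) + 2 * (y1 - y0)).
  rewrite mulrAC ler_pdivlMr ?mulr_gt0// ler_pM2l//.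
  by move: x0u x1l y0u y1l; clear; lra.
move: circ0 B0 B1 B2 B3 perim; rewrite /circulation !mulrDr.
set s0 := seg (P ^~ y0) _ _; set s1 := seg (P ^~ y1) _ _.
set s2 := seg (Q x1) _ _; set s3 := seg (Q x0) _ _; rewrite /m.
by clear; lra.
Qed.

End cauchy_rectangle.

(** * Integration over boxes in the plane *)

Section plane_integrals.
Context {R : realType}.
Local Notation leb := (@lebesgue_measure R).
Implicit Types (x y a b e d r k K s t : R) (A B : set R).

Lemma continuous_plane_measurable (D : set (R * R)) (h : R * R -> R) : measurable D ->
  (forall p, D p -> {for p, continuous h}) -> measurable_fun D h.
Proof.
move=> mD ch _; apply: (measurability _ (measurable_realfun.RGenOInfty.measurableE R)) => //.
move=> _ [_ [a ->] <-].
rewrite (_ : _ `&` _ = D `&` interior [set p | a < h p]).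
  by apply: measurableI => //; apply: open_measurable_plane; exact: open_interior.
apply/seteqP; split => p /= [Dp].
  rewrite in_itv/= andbT => hp; split => //.
  by have := ch p Dp => /(_ [set x | a < x]); apply; exact: lt_nbhsr.
by move=> /interior_subset hp; split => //; rewrite in_itv/= andbT.
Qed.

Definition box x0 x1 y0 y1 : set (R * R) := `[x0, x1] `*` `[y0, y1].

Lemma measurable_box x0 x1 y0 y1 : measurable (box x0 x1 y0 y1).
Proof. by apply: measurableX; exact: measurable_itv. Qed.

Lemma plane_lebesgue_box x0 x1 y0 y1 : x0 <= x1 -> y0 <= y1 ->
  plane_lebesgue (box x0 x1 y0 y1) = ((x1 - x0) * (y1 - y0))%:E.
Proof.
have len s t : s <= t -> leb (`[s, t]%classic : set R) = (t - s)%:E.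
  by rewrite lebesgue_measure_itv/= lte_fin; case: ltgtP => //= -> _; rewrite subrr.
move=> /len xx /len yy; rewrite EFinM -xx -yy.
exact: product_measure1E.
Qed.

Lemma tonelli_boxx (f : R * R -> \bar R) A B : measurable A -> measurable B ->
  measurable_fun (A `*` B) f -> (forall p, (0 <= f p)%E) ->
  (\int[plane_lebesgue]_(p in A `*` B) f p =
   \int[leb]_(x in A) \int[leb]_(y in B) f (x, y))%E.
Proof.
move=> mA mB mf f0; rewrite integral_mkcond /plane_lebesgue fubini_tonelli1; last 2 first.
- by apply/(measurable_restrictT _ (measurableX mA mB)).
- by move=> p; apply: erestrict_ge0.
rewrite [RHS]integral_mkcond; apply: eq_integral => x _ /=; rewrite /fubini_F [RHS]patchE.
case: ifPn => [xA|xA].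
  rewrite [RHS]integral_mkcond; apply: eq_integral => y _; rewrite !patchE in_setX/=.
  by rewrite xA.
by apply: integral0_eq => y _; rewrite patchE in_setX/= (negPf xA).
Qed.

Lemma tonelli_boxy (f : R * R -> \bar R) A B : measurable A -> measurable B ->
  measurable_fun (A `*` B) f -> (forall p, (0 <= f p)%E) ->
  (\int[plane_lebesgue]_(p in A `*` B) f p =
   \int[leb]_(y in B) \int[leb]_(x in A) f (x, y))%E.
Proof.
move=> mA mB mf f0; rewrite integral_mkcond /plane_lebesgue fubini_tonelli2; last 2 first.
- by apply/(measurable_restrictT _ (measurableX mA mB)).
- by move=> p; apply: erestrict_ge0.
rewrite [RHS]integral_mkcond; apply: eq_integral => y _ /=; rewrite /fubini_G [RHS]patchE.
case: ifPn => [yB|yB].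
  rewrite [RHS]integral_mkcond; apply: eq_integral => x _; rewrite !patchE in_setX/=.
  by rewrite yB andbT.
by apply: integral0_eq => x _; rewrite patchE in_setX/= (negPf yB) andbF.
Qed.

Lemma measurable_slicex (f : R * R -> \bar R) A B : measurable A -> measurable B ->
  measurable_fun (A `*` B) f -> (forall p, (0 <= f p)%E) ->
  measurable_fun A (fun x => \int[leb]_(y in B) f (x, y))%E.
Proof.
move=> mA mB mf f0; apply/measurable_restrictT => //.
have := @measurable_fun_fubini_tonelli_F _ _ _ _ R leb (f \_ (A `*` B)).
move=> H; have {}H := H _ _; apply: eq_measurable_fun (H _ _).
- move=> x _; rewrite /fubini_F patchE; case: ifPn => xA.
    rewrite [RHS]integral_mkcond; apply: eq_integral => y _; rewrite !patchE in_setX/=.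
    by rewrite xA.
  by apply: integral0_eq => y _; rewrite patchE in_setX/= (negPf xA).
- by apply/(measurable_restrictT _ (measurableX mA mB)).
- by move=> p; apply: erestrict_ge0.
Qed.

Lemma measurable_slicey (f : R * R -> \bar R) A B : measurable A -> measurable B ->
  measurable_fun (A `*` B) f -> (forall p, (0 <= f p)%E) ->
  measurable_fun B (fun y => \int[leb]_(x in A) f (x, y))%E.
Proof.
move=> mA mB mf f0; apply/measurable_restrictT => //.
have := @measurable_fun_fubini_tonelli_G _ _ _ _ R leb (f \_ (A `*` B)).
move=> H; have {}H := H _ _; apply: eq_measurable_fun (H _ _).
- move=> y _; rewrite /fubini_G patchE; case: ifPn => yB.
    rewrite [RHS]integral_mkcond; apply: eq_integral => x _; rewrite !patchE in_setX/=.
    by rewrite yB andbT.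
  by apply: integral0_eq => x _; rewrite patchE in_setX/= (negPf yB) andbF.
- by apply/(measurable_restrictT _ (measurableX mA mB)).
- by move=> p; apply: erestrict_ge0.
Qed.

(** Otherwise [h] exceeds [K] on the whole segment and its integral is at least
    [K * (t - s)]. *)
Lemma exists_small_value (h : R -> \bar R) A s t K : measurable A -> s < t -> 0 <= K ->
  `[s, t] `<=` A -> measurable_fun A h -> (forall x, (0 <= h x)%E) ->
  (\int[leb]_(x in A) h x < (K * (t - s))%:E)%E ->
  exists2 x, s <= x <= t & (h x <= K%:E)%E.
Proof.
move=> mA st K0 sub mh h0; apply: contraPP => /forall2NP no; apply/negP; rewrite -leNgt.
have <- : (\int[leb]_(x in `[s, t]) K%:E = (K * (t - s))%:E)%E.
  rewrite integral_cst// EFinM; congr (_ * _)%E.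
  by have := @lebesgue_measure_itv R `[s, t]; rewrite /= lte_fin st => ->.
have le_sub := ge0_subset_integral leb (measurable_itv `[s, t]) mA mh (fun x _ => h0 x) sub.
apply: le_trans le_sub.
apply: ge0_le_integral => //; first exact: measurable_funS mh.
move=> x; rewrite /= in_itv/= => xst; have [//|/negP] := no x.
by rewrite -ltNge => /ltW.
Qed.

End plane_integrals.

(** * Point evaluations are controlled by area integrals *)

Section point_bound.
Context {R : realType}.
Local Notation C := (cplx R).
Local Notation leb := (@lebesgue_measure R).
Implicit Types (x y a b e d r k K s t : R) (A B : set R).

Lemma modulus_plane_continuous (f : C -> C) (p : R * R) : derivable f (of_plane p) 1 ->
  {for p, continuous (fun p => normc (f (of_plane p)))}.
Proof.
move=> df; apply: (@continuous_comp _ _ _ (f \o of_plane) (@normc R : C -> R)).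
  apply: continuous_comp; first exact: of_plane_continuous.
  exact/differentiable_continuous/derivable1_diffP.
exact: normc_continuous.
Qed.

Lemma seg_EFin (h : R -> R) a b : {in `[a, b], continuous h} ->
  (seg h a b)%:E = (\int[leb]_(x in `[a, b]) (h x)%:E)%E.
Proof. by move=> ch; rewrite /seg fineK//; apply: integrable_fin_num => //; exact: seg_integrable. Qed.

Definition square a b r : set (R * R) := box (a - r) (a + r) (b - r) (b + r).

(** The estimate of [cauchy_rectangle] holds for every choice of the four sides
    in the outer part of the square. Each side is chosen so that the integral
    of [|f|] along its line is at most the average over the admissible
    positions, up to [e]; the average is bounded by the area integral through
    Tonelli's theorem. *)
Lemma point_bound (f : C -> C) a b r : 0 < r ->
  (forall x y, `|x - a| <= r -> `|y - b| <= r -> derivable f (x +i* y) 1) ->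
  ((normc (f (a +i* b)))%:E <= (16 / r ^+ 2)%:E *
    \int[plane_lebesgue]_(p in square a b r) (normc (f (of_plane p)))%:E)%E.
Proof.
move=> r0 df.
have lenl c : c - r / 2 - (c - r) = r / 2 by field.
have lenr c : c + r - (c + r / 2) = r / 2 by field.
have midl c : c - r / 2 <= c + r by lra.
have midr c : c - r <= c + r / 2 by lra.
have mid c : c - r / 2 <= c + r / 2 by lra.
rewrite /square /box; set A : set R := `[a - r, a + r]%classic; set B : set R := `[b - r, b + r]%classic.
have mA : measurable A by exact: measurable_itv.
have mB : measurable B by exact: measurable_itv.
have inA (x : R) : A x <-> `|x - a| <= r.
  by rewrite /A /= in_itv/= ler_distl.
have inB (y : R) : B y <-> `|y - b| <= r.
  by rewrite /B /= in_itv/= ler_distl.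
pose F (p : R * R) : \bar R := (normc (f (of_plane p)))%:E.
have F0 p : (0 <= F p)%E by rewrite lee_fin normc_ge0.
have mF : measurable_fun (A `*` B) F.
  apply/measurable_EFinP; apply: continuous_plane_measurable; first exact: measurableX.
  by move=> [x y] [/= /inA xA /inB yB]; apply: modulus_plane_continuous; exact: df.
set I := (\int[_]_(p in _) _)%E.
have I0 : (0 <= I)%E by apply: integral_ge0 => p _; exact: F0.
have [Ioo|] := eqVneq I +oo%E.
  by rewrite Ioo mulry gtr0_sg ?mul1e ?leey// divr_gt0// exprn_gt0.
rewrite -ltey => Ifin; have Ifn : I \is a fin_num by rewrite ge0_fin_numE.
set i := fine I; have iE : I = i%:E by rewrite fineK.
have i0 : 0 <= i by rewrite -lee_fin -iE.
rewrite iE -EFinM lee_fin; apply/ler_addgt0Pr => e e0.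
pose K := 2 / r * (i + e * r ^+ 2 / 16).
have K0 : 0 <= K by rewrite mulr_ge0 ?divr_ge0 ?addr_ge0 ?mulr_ge0 ?exprn_ge0// ltW.
have IK : (I < (K * (r / 2))%:E)%E.
  rewrite iE lte_fin (_ : K * (r / 2) = i + e * r ^+ 2 / 16); last first.
    by rewrite /K; field; rewrite gt_eqF.
  by rewrite ltrDl divr_gt0// mulr_gt0// exprn_gt0.
have pickx s t : t - s = r / 2 -> a - r <= s -> t <= a + r ->
    exists2 x, s <= x <= t & (\int[leb]_(y in B) F (x, y) <= K%:E)%E.
  move=> st sa ta; apply: (@exists_small_value _ _ A) => //.
  - by rewrite -subr_gt0 st divr_gt0.
  - by move=> x; rewrite /A /= !in_itv/= => /andP[sx xt]; rewrite (le_trans sa sx) (le_trans xt ta).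
  - exact: measurable_slicex.
  - by move=> x; exact: integral_ge0.
  by rewrite st -tonelli_boxx.
have picky s t : t - s = r / 2 -> b - r <= s -> t <= b + r ->
    exists2 y, s <= y <= t & (\int[leb]_(x in A) F (x, y) <= K%:E)%E.
  move=> st sa ta; apply: (@exists_small_value _ _ B) => //.
  - by rewrite -subr_gt0 st divr_gt0.
  - by move=> x; rewrite /B /= !in_itv/= => /andP[sx xt]; rewrite (le_trans sa sx) (le_trans xt ta).
  - exact: measurable_slicey.
  - by move=> x; exact: integral_ge0.
  by rewrite st -tonelli_boxy.
have [x0 x0P Fx0] := pickx (a - r) (a - r / 2) (lenl a) (lexx _) (midl a).
have [x1 x1P Fx1] := pickx (a + r / 2) (a + r) (lenr a) (midr a) (lexx _).
have [y0 y0P Fy0] := picky (b - r) (b - r / 2) (lenl b) (lexx _) (midl b).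
have [y1 y1P Fy1] := picky (b + r / 2) (b + r) (lenr b) (midr b) (lexx _).
have xA x : x0 <= x <= x1 -> A x.
  move: x0P x1P => /andP[x0l _] /andP[_ x1u] /andP[xl xu]; apply/inA.
  by rewrite ler_distl (le_trans x0l xl) (le_trans xu x1u).
have yB y : y0 <= y <= y1 -> B y.
  move: y0P y1P => /andP[y0l _] /andP[_ y1u] /andP[yl yu]; apply/inB.
  by rewrite ler_distl (le_trans y0l yl) (le_trans yu y1u).
have segx y : B y -> (\int[leb]_(x in A) F (x, y) <= K%:E)%E -> seg (modulus f ^~ y) x0 x1 <= K.
  move=> yy; rewrite -lee_fin seg_EFin; last first.
    move=> x; rewrite in_itv/= => /xA/inA xx; apply: derivable_continuous_x.
    by apply: df => //; exact/inB.
  apply: le_trans; apply: (ge0_subset_integral leb (measurable_itv `[x0, x1]) mA _ (fun x _ => F0 (x, y))).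
    apply: (measurable_comp (measurableX mA mB) _ mF); last exact/measurable_funTS/measurable_pair2.
    by move=> _ [x xx <-].
  by move=> x /= ; rewrite in_itv/=; exact: xA.
have segy x : A x -> (\int[leb]_(y in B) F (x, y) <= K%:E)%E -> seg (modulus f x) y0 y1 <= K.
  move=> xx; rewrite -lee_fin seg_EFin; last first.
    move=> y; rewrite in_itv/= => /yB/inB yy; apply: derivable_continuous_y.
    by apply: df => //; exact/inA.
  apply: le_trans; apply: (ge0_subset_integral leb (measurable_itv `[y0, y1]) mB _ (fun y _ => F0 (x, y))).
    apply: (measurable_comp (measurableX mA mB) _ mF); last exact/measurable_funTS/measurable_pair1.
    by move=> _ [y yy <-].
  by move=> y /= ; rewrite in_itv/=; exact: yB.
have x01 : x0 <= x1.
  by move: x0P x1P => /andP[_ x0u] /andP[x1l _]; exact: le_trans x0u (le_trans (mid a) x1l).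
have y01 : y0 <= y1.
  by move: y0P y1P => /andP[_ y0u] /andP[y1l _]; exact: le_trans y0u (le_trans (mid b) y1l).
have s1 : seg (modulus f ^~ y0) x0 x1 <= K by apply: segx => //; apply: yB; rewrite lexx.
have s2 : seg (modulus f ^~ y1) x0 x1 <= K by apply: segx => //; apply: yB; rewrite lexx andbT.
have s3 : seg (modulus f x1) y0 y1 <= K by apply: segy => //; apply: xA; rewrite lexx andbT.
have s4 : seg (modulus f x0) y0 y1 <= K by apply: segy => //; apply: xA; rewrite lexx.
apply: le_trans (cauchy_rectangle r0 x0P x1P y0P y1P df) _.
have -> : 16 / r ^+ 2 * i + e = 2 / r * (K + K + K + K).
  by rewrite /K; field; rewrite gt_eqF.
by rewrite ler_pM2l ?divr_gt0// !lerD.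
Qed.

End point_bound.

(** * The gliding hump *)

Section gliding_hump.
Context d (T : measurableType d) (R : realType).
Variables (mu : {measure set T -> \bar R}) (D : set T).
Hypothesis mD : measurable D.
Implicit Types (g h w : T -> R) (E : set T).

Lemma integrable_funZ (k : R) g : mu.-integrable D (EFin \o g) ->
  mu.-integrable D (EFin \o (fun x => k * g x)).
Proof. by move=> ig; have := integrableZl mD k ig; apply: eq_integrable. Qed.

Lemma integrable_funD g h : mu.-integrable D (EFin \o g) -> mu.-integrable D (EFin \o h) ->
  mu.-integrable D (EFin \o (fun x => g x + h x)).
Proof. by move=> ig ih; have := integrableD mD ig ih; apply: eq_integrable. Qed.

Lemma L1_patch g E : measurable E -> mu.-integrable D (EFin \o g) ->
  mu.-integrable D (EFin \o ((fun x => `|g x|) \_ E)).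
Proof.
move=> mE ig; have := (integrable_restrict mu mE mD (EFin \o (fun x => `|g x|))).1.
move=> /(_ (integrableS mD (measurableI _ _ mD mE) (@subIsetl _ _ _) (integrable_norm ig))).
by apply: eq_integrable => // x _; rewrite restrict_EFin.
Qed.

Lemma integral_vanish g (E : nat -> set T) (e : R) : mu.-integrable D (EFin \o g) ->
  (forall n, measurable (E n)) -> (forall x, D x -> \forall n \near \oo, ~ E n x) ->
  0 < e -> \forall n \near \oo, \int[mu]_(x in D `&` E n) `|g x| < e.
Proof.
move=> ig mE vE e0.
have [] := @dominated_convergence _ _ _ mu D mD
  (fun n => EFin \o ((fun x => `|g x|) \_ (E n))) (cst 0%E) (EFin \o (fun x => `|g x|)).
- by move=> n; have /integrableP[] := L1_patch (mE n) ig.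
- exact: measurable_cst.
- apply: aeW => x Dx; apply: cvg_near_cst; apply: filterS (vE x Dx) => n nE.
  by rewrite /= patchE memNset.
- exact: integrable_norm.
- apply: aeW => x n Dx; rewrite /= lee_fin patchE.
  by case: ifPn; rewrite ?normr_id ?normr0.
move=> _ _; rewrite integral0 => /fine_cvgP[_] /cvgrPdist_lt /(_ e e0).
apply: filterS => n; rewrite sub0r normrN /=.
by rewrite Rintegral_mkcondr => /(le_lt_trans (ler_norm _)).
Qed.

(** Suppose infinitely many integrals of [|v n|] are at least [e]. Alternately
    choosing an index [n] so large that [v n] has little mass in [S m], and
    then [m'] so large that it has little mass outside [S m'], one gets terms
    that have all but [e / 4] of their mass on disjoint sets [A k]. For the
    function [h] that is the sign of the k-th term on [A k], the integral
    of this term against [h] is at least [e / 2] for every k. *)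
Lemma gliding_hump (v : nat -> T -> R) (S : nat -> set T) (e : R) :
  (forall n, mu.-integrable D (EFin \o v n)) ->
  (forall m, measurable (S m)) -> (forall m n, (m <= n)%N -> S m `<=` S n) ->
  (forall x, D x -> exists m, S m x) ->
  (forall m (c : R), 0 < c -> \forall n \near \oo, \int[mu]_(x in D `&` S m) `|v n x| < c) ->
  (forall h, measurable_fun D h -> (forall x, `|h x| <= 1) ->
    forall c : R, 0 < c -> \forall n \near \oo, `|\int[mu]_(x in D) (v n x * h x)| < c) ->
  0 < e -> \forall n \near \oo, \int[mu]_(x in D) `|v n x| < e.
Proof.
move=> iv mS S_incr S_exh small weak e0; apply: contrapT => nsmall.
have often N : exists2 n, (N < n)%N & e <= \int[mu]_(x in D) `|v n x|.
  apply: contrapT => /forall2NP no; apply: nsmall; exists N.+1 => // n /= Nn.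
  by case: (no n) => [/negP|/negP]; [rewrite -leqNgt leqNgt Nn|rewrite -ltNge].
have e8 : 0 < e / 8 by rewrite divr_gt0.
pose next (p q : nat * nat) := [/\ (p.1 < q.1)%N, (p.2 <= q.2)%N,
  e <= \int[mu]_(x in D) `|v q.1 x|,
  \int[mu]_(x in D `&` S p.2) `|v q.1 x| < e / 8 &
  \int[mu]_(x in D `&` ~` S q.2) `|v q.1 x| < e / 8].
have ex_next p : {q | next p q}.
  apply: cid; have [N _ NP] := small p.2 _ e8.
  have [n] := often (maxn p.1 N); rewrite gtn_max => /andP[p1n Nn] en.
  have [M _ MP] : \forall m \near \oo, \int[mu]_(x in D `&` ~` S m) `|v n x| < e / 8.
    apply: integral_vanish => // [m|x Dx]; first exact: measurableC.
    have [m Smx] := S_exh x Dx; exists m => // k /= mk; apply.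
    exact: (S_incr _ _ mk x Smx).
  exists (n, maxn p.2 M); split => //=; first exact: leq_maxl.
  - by apply: NP; exact: ltnW.
  - by apply: MP; exact: leq_maxr.
have [r [_ rS]] := dependent_choice ex_next (0%N, 0%N).
(* The k-th hump w k, found at step k, lives on A k. *)
pose w k := v (r k.+1).1; pose A k := S (r k.+1).2 `\` S (r k).2.
have mw k : measurable_fun D (w k) by have /integrableP[/measurable_EFinP] := iv (r k.+1).1.
have mA k : measurable (A k) by exact: measurableD.
have r_incr i j : (i <= j)%N -> ((r i).2 <= (r j).2)%N.
  elim: j => [|j IH]; first by rewrite leqn0 => /eqP->.
  rewrite leq_eqVlt => /predU1P[->//|]; rewrite ltnS => /IH le_r.
  by apply: leq_trans le_r _; case: (rS j).
have A_disj i j x : A i x -> A j x -> i = j.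
  wlog ij : i j / (i <= j)%N => [H Ai Aj|].
    by case/orP: (leq_total i j) => h; [exact: H|apply/esym; exact: H].
  move: ij; rewrite leq_eqVlt => /predU1P[//|ij] [Si _] [_ nSj].
  by exfalso; apply: nSj; apply: S_incr Si; exact: r_incr.
pose sign (t : R) : R := if 0 <= t then 1 else -1.
pose h x : R := if pselect (exists k, A k x) is left ex then sign (w (projT1 (cid ex)) x) else 0.
have hA k x : A k x -> h x = sign (w k x).
  move=> Akx; rewrite /h; case: pselect => [ex|[]]; last by exists k.
  by case: cid => j Aj /=; rewrite (A_disj _ _ _ Aj Akx).
have hle1 x : `|h x| <= 1.
  rewrite /h; case: pselect => [ex|_]; last by rewrite normr0.
  by rewrite /sign; case: ifP => _; rewrite ?normrN normr1.
have mh : measurable_fun D h.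
  have -> : D = \bigcup_k (D `&` A k) `|` (D `\` \bigcup_k A k).
    by rewrite -setI_bigcupr setUIDK.
  apply/measurable_funU.
  - by apply: bigcup_measurable => k _; exact: measurableI.
  - by apply: measurableD => //; exact: bigcup_measurable.
  split.
    apply/measurable_fun_bigcup => k; first exact: measurableI.
    apply: (@eq_measurable_fun _ _ _ _ _ (fun x => sign (w k x))).
      by move=> x /set_mem[_ Akx]; rewrite (hA k).
    have mDA : measurable (D `&` A k) by exact: measurableI.
    apply: measurable_fun_if => //.
    apply: measurable_fun_ler; first exact: measurable_cst.
    by apply: measurable_funS (mw k).
  apply: (@eq_measurable_fun _ _ _ _ _ (fun=> 0 : R)); last exact: measurable_cst.
  move=> x /set_mem[_ nA]; rewrite /h; case: pselect => // -[k Ak].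
  by exfalso; apply: nA; exists k.
have r1_lt k : (k <= (r k).1)%N.
  by elim: k => [//|k IH]; have [lt_r _ _ _ _] := rS k; exact: leq_ltn_trans IH lt_r.
have [N _ NP] := weak h mh hle1 (e / 2) ltac:(by rewrite divr_gt0).
have := NP (r N.+1).1 (leq_trans (leqnSn N) (r1_lt N.+1)); apply/negP; rewrite -leNgt.
apply: le_trans (ler_norm _).
have [_ _ big inner outer] := rS N; set f := v (r N.+1).1 in big inner outer *.
have mI := mS (r N).2; have mO := measurableC (mS (r N.+1).2).
have if_ : mu.-integrable D (EFin \o f) by exact: iv.
have ifI := L1_patch mI if_; have ifO := L1_patch mO if_.
have ifh : mu.-integrable D (EFin \o (fun x => f x * h x)).
  have mf : measurable_fun D f by have /integrableP[/measurable_EFinP] := if_.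
  apply: le_integrable if_ => //.
    by apply/measurable_EFinP; exact: measurable_funM.
  by move=> x _; rewrite /= lee_fin normrM ler_piMr.
move: inner outer; rewrite !Rintegral_mkcondr.
set gI := _ \_ _ in ifI *; set gO := _ \_ _ in ifO *.
move=> inner outer.
(* On A N the product f * h is |f|; elsewhere it is at least - |f|, and one of
   the two other terms is 2 * |f|. *)
have : \int[mu]_(x in D) `|f x| <= \int[mu]_(x in D) (f x * h x + 2 * gI x + 2 * gO x).
  apply: le_Rintegral => //; first exact: integrable_norm.
    exact: integrable_funD (integrable_funD ifh (integrable_funZ 2 ifI)) (integrable_funZ 2 ifO).
  move=> x Dx; rewrite /gI /gO !patchE -[point]/(0 : R) /=.
  have fh : - `|f x| <= f x * h x.
    by rewrite lerNl; apply: le_trans (ler_norm _) _; rewrite normrN normrM ler_piMr.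
  have f0 := normr_ge0 (f x).
  case: ifPn => [_|/negP xI]; first by case: ifPn => _ /=; lra.
  case: ifPn => [_|/negP xO] /=; first lra.
  rewrite (hA N); last first.
    by split; [apply: contrapT => nS; apply: xO; exact/mem_set|move=> Sx; apply: xI; exact/mem_set].
  rewrite /sign /w -/f; case: ifPn => [f0'|]; first by rewrite ger0_norm//; lra.
  by rewrite -ltNge => f0'; rewrite ltr0_norm//; lra.
rewrite RintegralD//; [|exact: integrable_funD ifh (integrable_funZ 2 ifI)|exact: integrable_funZ].
rewrite RintegralD//; [|exact: integrable_funZ].
rewrite !RintegralZl//; lra.
Qed.

End gliding_hump.

(** * Elements of the Bergman space *)

Section bergman_elements.
Context {R : realType}.
Local Notation C := (cplx R).
Implicit Types (f g : A1 R) (x y a b e r : R) (p : R * R).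
Local Notation D := (@plane_disc R).

Lemma A1_analytic f : analytic_disc f.
Proof. by have [] := A1P f. Qed.

Lemma A1_off_disc f (z : C) : ~ disc z -> f z = 0.
Proof. by have [_ _ +] := A1P f; apply. Qed.

Lemma plane_disc_box : D `<=` box (-1) 1 (-1) 1.
Proof.
move=> [x y]; rewrite /plane_disc /disc /= => h; split; rewrite /= in_itv/= -ler_norml.
  by apply: le_trans (ltW h); exact: (Re_le_normc (x +i* y)).
by apply: le_trans (ltW h); exact: (Im_le_normc (x +i* y)).
Qed.

(** The disc as a measurable set for the product structure that carries
    [plane_lebesgue], whose display differs from the one inferred on [R * R]. *)
Lemma measurable_disc : measurable (D : set (measurableTypeR R * measurableTypeR R)).
Proof. exact: plane_disc_measurable. Qed.

Lemma plane_disc_lty : (plane_lebesgue D < +oo)%E.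
Proof.
apply: (@le_lt_trans _ _ (plane_lebesgue (box (-1) 1 (-1) 1 : set (R * R)))); last first.
  by rewrite plane_lebesgue_box ?ltry//; lra.
apply: le_measure; rewrite ?inE; [exact: plane_disc_measurable|exact: measurable_box|].
exact: plane_disc_box.
Qed.

Lemma A1_plane_continuous f p : D p -> {for p, continuous (f \o of_plane)}.
Proof.
move=> Dp; apply: continuous_comp; first exact: of_plane_continuous.
exact/differentiable_continuous/derivable1_diffP/A1_analytic.
Qed.

Lemma Re_continuous : continuous (fun z : C => complex.Re z).
Proof.
move=> z; apply/(@cvgrPdist_lt _ R^o C (nbhs z)) => e e0.
apply/(@nbhs_ballP _ C); exists e%:C; first by rewrite /= ltcR.
move=> w; rewrite -ball_normE /= normC_normc ltcR; apply: le_lt_trans.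
by rewrite -raddfB; exact: Re_le_normc.
Qed.

Lemma Im_continuous : continuous (fun z : C => complex.Im z).
Proof.
move=> z; apply/(@cvgrPdist_lt _ R^o C (nbhs z)) => e e0.
apply/(@nbhs_ballP _ C); exists e%:C; first by rewrite /= ltcR.
move=> w; rewrite -ball_normE /= normC_normc ltcR; apply: le_lt_trans.
by rewrite -raddfB; exact: Im_le_normc.
Qed.

Definition reA1 f p : R := complex.Re (f (of_plane p)).
Definition imA1 f p : R := complex.Im (f (of_plane p)).
Definition absA1 f p : R := normc (f (of_plane p)).

Lemma measurable_reA1 f : measurable_fun D (reA1 f).
Proof.
apply: continuous_plane_measurable; first exact: plane_disc_measurable.
move=> p Dp; apply: (@continuous_comp _ _ _ (f \o of_plane) (fun z : C => complex.Re z)).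
  exact: A1_plane_continuous.
exact: Re_continuous.
Qed.

Lemma measurable_imA1 f : measurable_fun D (imA1 f).
Proof.
apply: continuous_plane_measurable; first exact: plane_disc_measurable.
move=> p Dp; apply: (@continuous_comp _ _ _ (f \o of_plane) (fun z : C => complex.Im z)).
  exact: A1_plane_continuous.
exact: Im_continuous.
Qed.

Lemma integral_absA1 f :
  (\int[plane_lebesgue]_(p in D) (absA1 f p)%:E)%E = (pi * A1_norm f)%:E.
Proof.
rewrite EFinM A1_normE /bergman_enorm muleA -EFinM divff ?mul1e// gt_eqF//; exact: pi_gt0.
Qed.

Lemma integrable_absA1 f : plane_lebesgue.-integrable D (EFin \o absA1 f).
Proof.
apply/integrableP; split; first exact: analytic_emeasurable (A1_analytic (f := f)).
have -> : (\int[plane_lebesgue]_(p in D) `|(EFin \o absA1 f) p| = (pi * A1_norm f)%:E)%E.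
  rewrite -integral_absA1; apply: eq_integral => p _.
  by rewrite gee0_abs// lee_fin normc_ge0.
exact: ltry.
Qed.

Lemma Rintegral_absA1 f : \int[plane_lebesgue]_(p in D) absA1 f p = pi * A1_norm f.
Proof. by rewrite /Rintegral integral_absA1. Qed.

Lemma integrable_reA1 f : plane_lebesgue.-integrable D (EFin \o reA1 f).
Proof.
apply: le_integrable (integrable_absA1 f); first exact: plane_disc_measurable.
  by apply/measurable_EFinP; exact: measurable_reA1.
move=> p _; rewrite /= lee_fin; apply: le_trans (Re_le_normc _) _; exact: ler_norm.
Qed.

Lemma integrable_imA1 f : plane_lebesgue.-integrable D (EFin \o imA1 f).
Proof.
apply: le_integrable (integrable_absA1 f); first exact: plane_disc_measurable.
  by apply/measurable_EFinP; exact: measurable_imA1.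
move=> p _; rewrite /= lee_fin; apply: le_trans (Im_le_normc _) _; exact: ler_norm.
Qed.

Lemma A1_point_bound f (z : C) r : 0 < r -> normc z + 2 * r < 1 ->
  normc (f z) <= 16 / r ^+ 2 * (pi * A1_norm f).
Proof.
case: z => a b r0 zr.
have in_disc x y : `|x - a| <= r -> `|y - b| <= r -> disc (x +i* y).
  move=> xr yr; change (is_true (normc (x +i* y) < 1)); apply: le_lt_trans zr.
  have -> : x +i* y = (a +i* b) + ((x - a) +i* (y - b)) by apply/eqP; rewrite eq_complex /= !subrKC !eqxx.
  apply: le_trans (le_normcD _ _) _; rewrite lerD2l.
  by apply: le_trans (normc_le_ReIm _) _; rewrite /= (_ : 2 * r = r + r) ?lerD// mulr2n mulrDl mul1r.
have := point_bound (f := f) r0 (fun x y xr yr => A1_analytic (f := f) (in_disc x y xr yr)).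
have mS : measurable (square a b r) by exact: measurable_box.
have sub : square a b r `<=` D.
  move=> [x y]; rewrite /square /box /= !in_itv/= -!ler_distl => -[? ?].
  exact: in_disc.
move=> H; rewrite -lee_fin EFinM -integral_absA1; apply: le_trans H _.
apply: lee_wpmul2l; first by rewrite lee_fin divr_ge0// exprn_ge0// ltW.
apply: ge0_subset_integral => //; first exact: plane_disc_measurable.
  exact: analytic_emeasurable (A1_analytic (f := f)).
by move=> p _; rewrite lee_fin normc_ge0.
Qed.

End bergman_elements.

(** * Bounded functionals on the Bergman space *)

Section schur.
Context {R : realType}.
Local Notation C := (cplx R).
Implicit Types (f g : A1 R) (x y a b e r : R) (p : R * R) (h : R * R -> R).
Local Notation D := (@plane_disc R).
Local Notation leb2 := (@plane_lebesgue R).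

Lemma A1_norm_ge0 f : 0 <= A1_norm f.
Proof. by rewrite -lee_fin A1_normE bergman_enorm_ge0. Qed.

Lemma A1_normZ (a : R[i]) f : A1_norm (a *: f) = normc a * A1_norm f.
Proof.
have := normrZ a f; rewrite !A1_normrE normC_normc -rmorphM => /complexI.
by [].
Qed.

Lemma integrable_weighted (v : R * R -> R) h : measurable_fun D h -> (forall p, `|h p| <= 1) ->
  leb2.-integrable D (EFin \o v) -> leb2.-integrable D (EFin \o (fun p => v p * h p)).
Proof.
move=> mh h1 iv; have mv : measurable_fun D v by have /integrableP[/measurable_EFinP] := iv.
apply: le_integrable iv; first exact: measurable_disc.
  by apply/measurable_EFinP; exact: measurable_funM.
by move=> p _; rewrite /= lee_fin normrM ler_piMr.
Qed.

(** The integral of [f * h] over the disc, for a real weight [h]. *)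
Definition pairing h f : C :=
  (\int[leb2]_(p in D) (reA1 f p * h p)) +i* (\int[leb2]_(p in D) (imA1 f p * h p)).

Lemma pairing_linear h : measurable_fun D h -> (forall p, `|h p| <= 1) -> linear (pairing h).
Proof.
move=> mh h1 c f g; have mD := @measurable_disc R.
have iw k : leb2.-integrable D (EFin \o (fun p => reA1 k p * h p)).
  exact: integrable_weighted mh h1 (integrable_reA1 k).
have iw' k : leb2.-integrable D (EFin \o (fun p => imA1 k p * h p)).
  exact: integrable_weighted mh h1 (integrable_imA1 k).
have iZ (k : R) (w : R * R -> R) : leb2.-integrable D (EFin \o w) ->
    leb2.-integrable D (EFin \o (fun p => k * w p)).
  by apply: integrable_funZ; exact: measurable_disc.
have iD (w1 w2 : R * R -> R) : leb2.-integrable D (EFin \o w1) ->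
    leb2.-integrable D (EFin \o w2) -> leb2.-integrable D (EFin \o (fun p => w1 p + w2 p)).
  by apply: integrable_funD; exact: measurable_disc.
case: c => c1 c2.
have combE z : ((c1 +i* c2) *: f + g) z = (c1 +i* c2) * f z + g z by [].
have reE p : reA1 ((c1 +i* c2) *: f + g) p * h p =
    c1 * (reA1 f p * h p) + (- c2) * (imA1 f p * h p) + reA1 g p * h p.
  by rewrite /reA1 /imA1 combE; case: (f _) (g _) => [? ?] [? ?] /=; ring.
have imE p : imA1 ((c1 +i* c2) *: f + g) p * h p =
    c1 * (imA1 f p * h p) + c2 * (reA1 f p * h p) + imA1 g p * h p.
  by rewrite /reA1 /imA1 combE; case: (f _) (g _) => [? ?] [? ?] /=; ring.
rewrite /pairing; apply/eqP; rewrite eq_complex; apply/andP; split; apply/eqP => /=.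
- rewrite (@eq_Rintegral _ _ _ leb2 D
    (fun p => c1 * (reA1 f p * h p) + (- c2) * (imA1 f p * h p) + reA1 g p * h p)); last first.
    by move=> p _; exact: reE.
  rewrite RintegralD//; [|by apply: (iD _ _ (iZ _ _ (iw f)) (iZ _ _ (iw' f)))].
  rewrite RintegralD//; [|exact: iZ|exact: iZ].
  by rewrite !RintegralZl// mulNr.
- rewrite (@eq_Rintegral _ _ _ leb2 D
    (fun p => c1 * (imA1 f p * h p) + c2 * (reA1 f p * h p) + imA1 g p * h p)); last first.
    by move=> p _; exact: imE.
  rewrite RintegralD//; [|by apply: (iD _ _ (iZ _ _ (iw' f)) (iZ _ _ (iw f)))].
  rewrite RintegralD//; [|exact: iZ|exact: iZ].
  by rewrite !RintegralZl.
Qed.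

Lemma pairing_bounded h : measurable_fun D h -> (forall p, `|h p| <= 1) ->
  bounded_operator (pairing h : A1 R -> C).
Proof.
move=> mh h1; have mD := @measurable_disc R; exists (2 * pi)%:C => f.
rewrite normC_normc A1_normrE -rmorphM lecR.
have bnd (v : R * R -> R) : leb2.-integrable D (EFin \o v) -> (forall p, `|v p| <= absA1 f p) ->
    `|\int[leb2]_(p in D) (v p * h p)| <= pi * A1_norm f.
  move=> iv vf; have iw := integrable_weighted mh h1 iv.
  apply: le_trans (le_normr_Rintegral mD iw) _; rewrite -Rintegral_absA1.
  apply: le_Rintegral => //; [exact: integrable_norm|exact: integrable_absA1|].
  by move=> p _; rewrite normrM; apply: le_trans (vf p); rewrite ler_piMr.
apply: le_trans (normc_le_ReIm _) _; rewrite -mulrA mulr2n mulrDl mul1r; apply: lerD.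
  by apply: bnd; [exact: integrable_reA1|move=> p; exact: Re_le_normc].
by apply: bnd; [exact: integrable_imA1|move=> p; exact: Im_le_normc].
Qed.

Definition evaluation (z : C) f : C := f z.

Lemma evaluation_linear (z : C) : linear (evaluation z).
Proof. by []. Qed.

Lemma disc_shrink (z : C) : disc z -> exists2 r, 0 < r & normc z + 2 * r < 1.
Proof.
rewrite /disc => z1; exists ((1 - normc z) / 4); first by rewrite divr_gt0// subr_gt0.
have : normc z < 1 by []; lra.
Qed.

Lemma evaluation_bounded (z : C) : bounded_operator (evaluation z : A1 R -> C).
Proof.
have [/disc_shrink[r r0 rz]|nz] := pselect (disc z); last first.
  by exists 0 => f; rewrite /evaluation A1_off_disc// normr0 mul0r.
exists (16 / r ^+ 2 * pi)%:C => f.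
have := A1_point_bound f r0 rz.
by rewrite mulrA normC_normc A1_normrE -rmorphM lecR.
Qed.

End schur.

(** * The Schur property *)

Section schur_property.
Context {R : realType}.
Local Notation C := (cplx R).
Implicit Types (u : nat -> A1 R) (f g : A1 R) (x y a b e r : R) (p : R * R) (h : R * R -> R).
Local Notation D := (@plane_disc R).
Local Notation leb2 := (@plane_lebesgue R).

Definition weakly_null u : Prop := forall L : {linear A1 R -> C}, bounded_operator L ->
  forall e : R, 0 < e -> \forall n \near \oo, normc (L (u n)) < e.

Lemma weakly_null_evaluation u (z : C) e : weakly_null u -> 0 < e ->
  \forall n \near \oo, normc (u n z) < e.
Proof.
move=> wu e0.
pose L : {linear A1 R -> C} := HB.pack (evaluation z)
  (GRing.isLinear.Build _ _ _ _ (evaluation z) (evaluation_linear z)).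
exact: (wu L (evaluation_bounded z) e e0).
Qed.

Lemma weakly_null_pairing u h e : measurable_fun D h -> (forall p, `|h p| <= 1) ->
  weakly_null u -> 0 < e -> \forall n \near \oo, normc (pairing h (u n)) < e.
Proof.
move=> mh h1 wu e0.
pose L : {linear A1 R -> C} := HB.pack (pairing h)
  (GRing.isLinear.Build _ _ _ _ (pairing h) (pairing_linear mh h1)).
exact: (wu L (pairing_bounded mh h1) e e0).
Qed.

Definition subdisc (m : nat) : set (R * R) := [set p | normc (of_plane p) < 1 - m.+2%:R^-1].

Lemma measurable_subdisc m :
  measurable (subdisc m : set (measurableTypeR R * measurableTypeR R)).
Proof.
apply: open_measurable_plane; rewrite openE => p pm.
have : {for p, continuous (fun p : R * R => normc (of_plane p))}.
  apply: (@continuous_comp _ _ _ (of_plane : R * R -> C) (@normc R : C -> R)).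
    exact: of_plane_continuous.
  exact: normc_continuous.
by move=> /(_ [set x | x < 1 - m.+2%:R^-1]); apply; exact: lt_nbhsl.
Qed.

Lemma subdisc_incr m n : (m <= n)%N -> subdisc m `<=` subdisc n.
Proof.
move=> mn p /lt_le_trans; apply; rewrite lerB// lef_pV2 ?posrE ?ltr0n//.
by rewrite ler_nat !ltnS.
Qed.

Lemma subdisc_exhaust p : D p -> exists m, subdisc m p.
Proof.
move=> Dp; have p1 : 0 < 1 - normc (of_plane p) by rewrite subr_gt0.
have [m _ mP] := near_infty_natSinv_lt (PosNum p1).
exists m; rewrite /subdisc /= ltrBrDr -ltrBrDl.
apply: le_lt_trans (mP m (leqnn m)).
by rewrite lef_pV2 ?posrE ?ltr0n// ler_nat.
Qed.

(** On a smaller disc [point_bound] gives one bound for the whole sequence, and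
    the sequence tends to 0 at every point, so dominated convergence applies. *)
Lemma weakly_null_compact u m e : (forall n, A1_norm (u n) <= 1) -> weakly_null u -> 0 < e ->
  \forall n \near \oo, \int[leb2]_(p in D `&` subdisc m) `|reA1 (u n) p| < e.
Proof.
(* With this r one has |z| + 2 * r < 1 on subdisc m. *)
move=> u1 wu e0; set r : R := m.+2%:R^-1 / 4.
have r0 : 0 < r by rewrite divr_gt0// invr_gt0 ltr0n.
have mDS : measurable (D `&` subdisc m : set (measurableTypeR R * measurableTypeR R)).
  by apply: measurableI; [exact: measurable_disc|exact: measurable_subdisc].
have bnd n p : subdisc m p -> normc (u n (of_plane p)) <= 16 / r ^+ 2 * pi.
  move=> Sp; apply: le_trans (A1_point_bound (u n) r0 _) _.
    have : normc (of_plane p) < 1 - m.+2%:R^-1 := Sp.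
    have : 0 < m.+2%:R^-1 :> R by rewrite invr_gt0 ltr0n.
    by rewrite /r; set q := m.+2%:R^-1; set s := normc _; lra.
  rewrite ler_wpM2l ?divr_ge0 ?exprn_ge0//; first exact: ltW.
  by rewrite ler_piMr// pi_ge0.
have [] := @dominated_convergence _ _ _ leb2 (D `&` subdisc m) mDS
  (fun n p => `|reA1 (u n) p|%:E) (cst 0%E) (EFin \o cst (16 / r ^+ 2 * pi)).
- move=> n; apply/measurable_EFinP; apply: measurableT_comp => //.
  by apply: measurable_funS (measurable_reA1 (u n)); [exact: measurable_disc|exact: subIsetl].
- exact: measurable_cst.
- apply: aeW => p [Dp Sp]; apply/fine_cvgP; split; first by apply: nearW.
  apply/cvgrPdist_lt => c c0; apply: filterS (weakly_null_evaluation (of_plane p) wu c0) => n.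
  rewrite sub0r normrN /= normr_id; apply: le_lt_trans; exact: Re_le_normc.
- apply: integrableS (@subIsetl _ _ _) _ => //; first exact: measurable_disc.
  apply: measurable_bounded_integrable => //; [exact: measurable_disc|exact: plane_disc_lty|].
  exact: bounded_cst.
- apply: aeW => p n [Dp Sp]; rewrite /= lee_fin normr_id.
  by apply: le_trans (bnd n p Sp); exact: Re_le_normc.
move=> _ _; rewrite integral0 => /fine_cvgP[_] /cvgrPdist_lt /(_ e e0).
by apply: filterS => n; rewrite sub0r normrN /=; apply: le_lt_trans; exact: ler_norm.
Qed.

Lemma weakly_null_re u e : (forall n, A1_norm (u n) <= 1) -> weakly_null u -> 0 < e ->
  \forall n \near \oo, \int[leb2]_(p in D) `|reA1 (u n) p| < e.
Proof.
move=> u1 wu; move=> e0; apply: (@gliding_hump _ _ _ leb2 D _ (fun n => reA1 (u n)) subdisc) => //.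
- exact: measurable_disc.
- by move=> n; exact: integrable_reA1.
- exact: measurable_subdisc.
- exact: subdisc_incr.
- exact: subdisc_exhaust.
- by move=> m c; exact: weakly_null_compact.
move=> h mh h1 c c0; apply: filterS (weakly_null_pairing mh h1 wu c0) => n.
apply: le_lt_trans; exact: (Re_le_normc (pairing h (u n))).
Qed.

Lemma weakly_nullZ u (c : R[i]) : normc c = 1 -> weakly_null u -> weakly_null (fun n => c *: u n).
Proof.
move=> c1 wu L bL e e0; apply: filterS (wu L bL e e0) => n.
by rewrite linearZ /= normcM c1 mul1r.
Qed.

(** The gliding hump uses the sign of a real function, so it is applied to the
    real parts of the sequence and of its multiple by [-i]. *)
Lemma weakly_null_bounded u e : (forall n, A1_norm (u n) <= 1) -> weakly_null u -> 0 < e ->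
  \forall n \near \oo, A1_norm (u n) < e.
Proof.
move=> u1 wu e0; pose c : R[i] := 0 +i* (-1).
have nc : normc c = 1 by rewrite /= expr0n add0r sqrrN expr1n sqrtr1.
have c1 n : A1_norm (c *: u n) <= 1 by rewrite A1_normZ nc mul1r.
have pe : 0 < pi * e / 2 by rewrite divr_gt0// mulr_gt0// pi_gt0.
apply: filterS2 (weakly_null_re u1 wu pe) (weakly_null_re c1 (weakly_nullZ nc wu) pe) => n.
have imE p : reA1 (c *: u n) p = imA1 (u n) p.
  have -> : reA1 (c *: u n) p = complex.Re (c * u n (of_plane p)) by [].
  by rewrite /imA1 /c; case: (u n _) => [s t] /=; ring.
have -> : \int[leb2]_(p in D) `|reA1 (c *: u n) p| = \int[leb2]_(p in D) `|imA1 (u n) p|.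
  by apply: eq_Rintegral => p _; rewrite imE.
move=> re_small im_small; rewrite -(ltr_pM2l (pi_gt0 R)) -Rintegral_absA1.
apply: (@le_lt_trans _ _ (\int[leb2]_(p in D) (`|reA1 (u n) p| + `|imA1 (u n) p|))).
  apply: le_Rintegral; [exact: measurable_disc|exact: integrable_absA1| |].
    apply: integrable_funD; [exact: measurable_disc| |]; apply: integrable_norm.
      exact: integrable_reA1.
    exact: integrable_imA1.
  by move=> p _; exact: normc_le_ReIm.
rewrite RintegralD; [lra|exact: measurable_disc| |]; apply: integrable_norm.
  exact: integrable_reA1.
exact: integrable_imA1.
Qed.

(** Division by [max 1 |u n|] keeps the sequence weakly null and makes it
    bounded, so that it tends to 0 in norm. As the quotient has norm exactly 1
    whenever [|u n| > 1], this also shows that [|u n| <= 1] eventually. In this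
    way the uniform boundedness principle is avoided. *)
Theorem schur_property u e : weakly_null u -> 0 < e -> \forall n \near \oo, A1_norm (u n) < e.
Proof.
move=> wu e0; pose k n : R := (Num.max 1 (A1_norm (u n)))^-1.
have k0 n : 0 < k n by rewrite invr_gt0 lt_max ltr01.
have nk n : normc (k n)%:C = k n by rewrite /= expr0n addr0 sqrtr_sqr ger0_norm// ltW.
have w1 n : A1_norm ((k n)%:C *: u n) <= 1.
  by rewrite A1_normZ nk mulrC ler_pdivrMr ?lt_max ?ltr01// mul1r le_max lexx orbT.
have ww : weakly_null (fun n => (k n)%:C *: u n).
  move=> L bL c c0; apply: filterS (wu L bL c c0) => n.
  rewrite linearZ /= normcM nk; apply: le_lt_trans; rewrite ler_piMl ?normc_ge0//.
  by rewrite invf_le1 ?lt_max ?ltr01// le_max lexx.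
have e1 : 0 < Num.min 1 e by rewrite lt_min ltr01.
apply: filterS (weakly_null_bounded w1 ww e1) => n; rewrite A1_normZ nk lt_min => /andP[].
rewrite /k; case: (leP (A1_norm (u n)) 1) => [u1 _|u1].
  by rewrite invr1 mul1r.
by rewrite mulVf ?ltxx// gt_eqF// (lt_trans ltr01).
Qed.

Lemma weakly_cvg_null u f : weakly_cvg u f -> weakly_null (fun n => u n - f).
Proof.
move=> wu L bL e e0; have /cvgrPdist_lt /(_ e%:C) := wu L bL.
rewrite ltcR => /(_ e0); apply: filterS => n.
by rewrite linearB normC_normc ltcR -normcN opprB.
Qed.

Lemma bounded_operator_real (T : A1 R -> A1 R) : bounded_operator T ->
  exists2 k : R, 0 < k & forall f, A1_norm (T f) <= k * A1_norm f.
Proof.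
move=> [[m1 m2] bT]; exists (`|m1| + 1) => [|f]; first by rewrite ltr_wpDl.
have := bT f; rewrite !A1_normrE lecE => /andP[_] /=; rewrite mulr0 subr0 => /le_trans; apply.
rewrite ler_wpM2r ?A1_norm_ge0//; apply: le_trans (ler_norm _) _.
by rewrite lerDl.
Qed.

Lemma A1_cvgP u f : (forall e, 0 < e -> \forall n \near \oo, A1_norm (u n - f) < e) <->
  u n @[n --> \oo] --> f.
Proof.
split=> [H|/cvgrPdist_lt H e e0].
  apply/cvgrPdist_lt => e e0.
  have ce : 0 < complex.Re e by move: e0; rewrite ltcE => /andP[].
  have -> : e = (complex.Re e)%:C by rewrite RRe_real// gtr0_real.
  by apply: filterS (H _ ce) => n; rewrite distrC A1_normrE ltcR.
have /H : 0 < e%:C :> R[i] by rewrite ltcR.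
by apply: filterS => n; rewrite distrC A1_normrE ltcR.
Qed.

Lemma bounded_completely_continuous (T : {linear A1 R -> A1 R}) :
  bounded_operator T -> completely_continuous T.
Proof.
move=> /bounded_operator_real[k k0 bT] u f /weakly_cvg_null wu; apply/cvg_ex; exists (T f).
apply/A1_cvgP => e e0; have ek : 0 < e / k by rewrite divr_gt0.
apply: filterS (schur_property wu ek) => n; rewrite /= -linearB ltr_pdivlMr// mulrC.
exact: le_lt_trans.
Qed.

End schur_property.

(** * The Dirac mass gives an operator of rank one *)

Section rank_one.
Context {R : realType}.
Local Notation C := (cplx R).
Implicit Types (u : nat -> A1 R) (f g : A1 R) (x y a b e r M : R) (p : R * R) (h : R * R -> R).
Local Notation D := (@plane_disc R).
Local Notation leb2 := (@plane_lebesgue R).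

Lemma bounded_A1 (g : C -> C) M : analytic_disc g -> (forall z, disc z -> normc (g z) <= M) ->
  exists f, forall z, disc z -> f z = g z.
Proof.
move=> ag gM; pose f0 : C -> C := fun z => if normc z < 1 then g z else 0.
have f0E z : disc z -> f0 z = g z by rewrite /disc /f0 /= => ->.
have af0 : analytic_disc f0.
  move=> z Dz; apply: near_eq_derivable (ag z Dz).
  have : \forall w \near z, disc w by apply: open_nbhs_nbhs; split => //; exact: disc_open.
  by apply: filterS => w /f0E.
suff bf0 : bergman_fun f0 by exists (MkA1 (asboolT bf0)).
split=> [//||z nz]; last by rewrite /f0; case: ifP => // h; case: nz.
have M0 : 0 <= M.
  have D0 : @disc R 0 by rewrite -[disc _]/(is_true (normc (0 : R[i]) < 1)) normc0.
  exact: le_trans (normc_ge0 _) (gM 0 D0).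
apply: (@le_lt_trans _ _ ((pi : R)^-1%:E * (M%:E * leb2 D))%E); last first.
  by rewrite muleA -EFinM; apply: lte_mul_pinfty; rewrite ?lee_fin ?mulr_ge0 ?invr_ge0 ?pi_ge0// plane_disc_lty.
apply: lee_wpmul2l; first by rewrite lee_fin invr_ge0 pi_ge0.
rewrite -integral_cst; last exact: measurable_disc.
apply: ge0_le_integral.
- exact: measurable_disc.
- by move=> p _; rewrite lee_fin normc_ge0.
- exact: analytic_emeasurable.
- exact: measurable_cst.
- by move=> p Dp; rewrite lee_fin f0E//; exact: gM.
Qed.

Lemma Rintegral_dirac0 (mu : probability (measurableTypeR R) R) (h : R -> R) :
  (forall A, measurable A -> mu A = \d_(0 : R) A) ->
  mu.-integrable `[0, 1[ (EFin \o h) -> \int[mu]_(t in `[0, 1[) h t = h 0.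
Proof.
move=> mu0 ih; have /integrableP[mh _] := ih.
rewrite /Rintegral (@eq_measure_integral _ _ _ _ (\d_(0 : measurableTypeR R))) => [|A mA _]; last exact: mu0.
rewrite integral_dirac// diracE mem_set ?mul1e//.
by rewrite /= in_itv/= lexx ltr01.
Qed.

Lemma Gamma_dirac0 (mu : probability (measurableTypeR R) R) (T : A1 R -> A1 R) f (z : C) :
  (forall A, measurable A -> mu A = \d_(0 : R) A) -> is_Gamma mu T -> disc z ->
  T f z = f 0 * (1 - z)^-1.
Proof.
move=> mu0 GT Dz; have [[ire iim] ->] := GT f z Dz.
rewrite /cintegral !Rintegral_dirac0//.
rewrite /phi /weight mul0r sub0r rmorphN1 mulN1r.
by case: (f 0 * _).
Qed.

Lemma increasing_seq_ge (s : nat -> nat) n : increasing_seq s -> (n <= s n)%N.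
Proof.
move=> si; elim: n => [//|n IH]; apply: leq_ltn_trans IH _.
by rewrite ltnNge -leEnat si -ltnNge.
Qed.

Lemma cvg_subseq (v : nat -> R) (l : R) (s : nat -> nat) : increasing_seq s ->
  v n @[n --> \oo] --> l -> v (s n) @[n --> \oo] --> l.
Proof.
move=> si vl; apply: cvg_comp vl => A [N _ NA]; exists N => // n /= Nn; apply: NA => /=.
exact: leq_trans Nn (increasing_seq_ge n si).
Qed.

Lemma bounded_fun_A1 u : bounded_fun u <-> exists b, forall n, A1_norm (u n) <= b.
Proof.
split=> [[B [_ uB]]|[b ub]].
  exists (complex.Re B + 1) => n.
  have un : `|u n| <= B + 1 by apply: uB => //; rewrite ltrDl.
  by move: un; rewrite A1_normrE lecE => /andP[_]; case: (B).
exists b%:C; split; first by rewrite realE !lecE /= eqxx le_total.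
move=> x bx n _; have un : `|u n| <= b%:C by rewrite A1_normrE lecR.
exact: le_trans un (ltW bx).
Qed.

Lemma bounded_fun_le (v : nat -> R) b : (forall n, `|v n| <= b) -> bounded_fun v.
Proof.
move=> vb; exists b; split; first exact: num_real.
by move=> x bx n _; apply: le_trans (ltW bx).
Qed.

(** The scalars [u n 0] are bounded, so the Bolzano-Weierstrass theorem,
    applied to the real parts and then to the imaginary parts, provides the
    subsequence. *)
Lemma rank_one_compact (T : A1 R -> A1 R) g : (forall f, T f = f 0 *: g) -> compact_operator T.
Proof.
move=> TE u /bounded_fun_A1[b ub].
have D0 : @disc R 0 by rewrite -[disc _]/(is_true (normc (0 : R[i]) < 1)) normc0.
have [r r0 zr] := disc_shrink D0.
have u0b n : normc (u n 0) <= 16 / r ^+ 2 * (pi * b).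
  apply: le_trans (A1_point_bound (u n) r0 zr) _.
  apply: ler_wpM2l; first by rewrite divr_ge0// exprn_ge0// ltW.
  by rewrite ler_wpM2l// pi_ge0.
have [s1 s1i /cvg_ex[/= l1 cv1]] := bolzano_weierstrass
  (bounded_fun_le (fun n => le_trans (Re_le_normc (u n 0)) (u0b n))).
have [s2 s2i /cvg_ex[/= l2 cv2]] := bolzano_weierstrass
  (bounded_fun_le (fun n => le_trans (Im_le_normc (u (s1 n) 0)) (u0b (s1 n)))).
exists (s1 \o s2); first by move=> m n /=; rewrite s1i -leEnat s2i.
apply/cvg_ex; exists ((l1 +i* l2) *: g); apply/A1_cvgP => e e0.
have g1 : 0 < A1_norm g + 1 by rewrite ltr_wpDl// A1_norm_ge0.
have e2 : 0 < e / (A1_norm g + 1) / 2 by rewrite !divr_gt0.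
have /cvgrPdist_lt/(_ _ e2) near1 := cvg_subseq s2i cv1.
move: cv2 => /cvgrPdist_lt/(_ _ e2) near2.
apply: filterS2 near1 near2 => n /=; set c := u _ 0; move=> n1 n2.
rewrite TE -/c -scalerBl A1_normZ.
have cl : normc (c - (l1 +i* l2)) < e / (A1_norm g + 1).
  apply: le_lt_trans (normc_le_ReIm _) _; rewrite [ltRHS]splitr.
  by case: (c) n1 n2 => [c1 c2] /= n1 n2; rewrite ltrD// distrC.
apply: (@le_lt_trans _ _ (normc (c - (l1 +i* l2)) * (A1_norm g + 1))).
  by rewrite ler_wpM2l ?normc_ge0// lerDl.
by rewrite -ltr_pdivlMr.
Qed.

Theorem dirac0_compact (mu : probability (measurableTypeR R) R) (T : A1 R -> A1 R) :
  (forall A, measurable A -> mu A = \d_(0 : R) A) -> is_Gamma mu T -> compact_operator T.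
Proof.
move=> mu0 GT.
have [one oneE] : exists f, forall z, disc z -> f z = 1.
  apply: (@bounded_A1 (fun=> 1) 1) => [z _|z _]; first exact: derivable_cst.
  by rewrite normc1.
have D0 : @disc R 0 by rewrite -[disc _]/(is_true (normc (0 : R[i]) < 1)) normc0.
apply: (@rank_one_compact _ (T one)) => f; apply/val_inj/funext => z.
have -> : val (f 0 *: T one) z = f 0 * T one z by [].
rewrite /=; have [Dz|nDz] := pselect (disc z); last first.
  by rewrite (A1_off_disc (T f) nDz) (A1_off_disc (T one) nDz) mulr0.
by rewrite (Gamma_dirac0 f mu0 GT Dz) (Gamma_dirac0 one mu0 GT Dz) oneE// mul1r.
Qed.

End rank_one.

(** * Elementary integrals *)

Section test_integrals.
Context {R : realType}.
Local Notation leb := (@lebesgue_measure R).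
Implicit Types (x y a b e r s t M : R) (p : R * R).

Lemma inv_affine_is_derive a b x : a + b * x != 0 ->
  is_derive x (1 : R) (fun x : R => (a + b * x)^-1 : R) (- ((a + b * x) ^- 2) * b).
Proof.
move=> nz; have d1 : is_derive x (1 : R) (fun x : R => a + b * x) b.
  by apply: is_derive_eq; rewrite /GRing.scale/= add0r mul1r mulr1.
exact: (@is_deriveV _ (fun x => a + b * x) x b 1 nz d1).
Qed.

Lemma seg_inv_sqr a b s t : b != 0 -> s <= t ->
  (forall x, s <= x <= t -> 0 < a + b * x) ->
  {in `[s, t], continuous (fun x => (a + b * x) ^- 2 : R)} /\
  seg (fun x => (a + b * x) ^- 2) s t = (t - s) / ((a + b * s) * (a + b * t)).
Proof.
move=> b0 st pos.
have dF x : s <= x <= t -> is_derive x (1 : R) (fun x : R => (a + b * x)^-1 : R) (- ((a + b * x) ^- 2) * b).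
  by move=> /pos /lt0r_neq0; exact: inv_affine_is_derive.
have cF x : s <= x <= t -> {for x, continuous (fun x : R => (a + b * x)^-1 : R)}.
  by move=> /dF H; apply/differentiable_continuous/derivable1_diffP; case: H.
have cF2 : {in `[s, t], continuous (fun x => (a + b * x) ^- 2 : R)}.
  move=> x; rewrite in_itv/= => /cF H.
  have -> : (fun x => (a + b * x) ^- 2 : R) = (fun x => (a + b * x)^-1 * (a + b * x)^-1).
    by apply/funext => y; rewrite expr2 invfM.
  exact: (cvgM H H).
split=> //; move: st; rewrite le_eqVlt => /predU1P[st|st].
  by rewrite st /seg set_itv1 Rintegral_set1 subrr mul0r.
pose F x : R := - b^-1 * (a + b * x)^-1.
have dFF x : s <= x <= t -> is_derive x (1 : R) F ((a + b * x) ^- 2).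
  move=> /dF H; rewrite /F; apply: is_derive_eq.
  by rewrite /GRing.scale/=; set q := _ ^- 2; field.
have cFF x : s <= x <= t -> {for x, continuous F}.
  by move=> /dFF H; apply/differentiable_continuous/derivable1_diffP; case: H.
have -> : (t - s) / ((a + b * s) * (a + b * t)) = F t - F s.
  have p1 := pos s ltac:(by rewrite lexx ltW); have p2 := pos t ltac:(by rewrite lexx ltW).
  by rewrite /F; field; rewrite b0 !lt0r_neq0.
apply: EFin_inj; rewrite seg_EFin// EFinB; apply: continuous_FTC2 => //.
- exact: continuous_in_subspaceT (fun x xx => cF2 x (set_mem xx)).
- split.
  + move=> x; rewrite in_itv/= => /andP[sx xt].
    by case: (dFF x) => //; rewrite !ltW.
  + by apply: cvg_at_right_filter; apply: cFF; rewrite lexx ltW.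
  + by apply: cvg_at_left_filter; apply: cFF; rewrite lexx ltW.
- move=> x; rewrite in_itv/= => /andP[sx xt]; rewrite derive1E.
  have H : is_derive x (1 : R) F ((a + b * x) ^- 2) by apply: dFF; rewrite !ltW.
  by rewrite derive_val.
Qed.

Lemma integral_box_product (g1 g2 : R -> R) x0 x1 y0 y1 :
  {in `[x0, x1], continuous g1} -> {in `[y0, y1], continuous g2} ->
  (forall x, 0 <= g1 x) -> (forall y, 0 <= g2 y) ->
  (\int[plane_lebesgue]_(p in box x0 x1 y0 y1) (g1 p.1 * g2 p.2)%:E =
   (seg g1 x0 x1 * seg g2 y0 y1)%:E)%E.
Proof.
move=> c1 c2 g10 g20.
have m1 : measurable_fun `[x0, x1] g1 by have /integrableP[/measurable_EFinP] := seg_integrable c1.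
have m2 : measurable_fun `[y0, y1] g2 by have /integrableP[/measurable_EFinP] := seg_integrable c2.
have i1 := seg_EFin c1; have i2 := seg_EFin c2.
rewrite tonelli_boxx//; last 2 first.
- apply/measurable_EFinP; apply: measurable_funM.
    apply: (measurable_comp (measurable_itv `[x0, x1]) _ m1) => //.
      by move=> _ [[x y] [/= xx _] <-].
    exact: measurable_funTS.
  have sub : snd @` box x0 x1 y0 y1 `<=` `[y0, y1]%classic by move=> _ [[x y] [/= _ yy] <-].
  exact: (measurable_comp (measurable_itv `[y0, y1]) sub m2 (measurable_funTS measurable_snd)).
- by move=> p; rewrite lee_fin mulr_ge0.
transitivity (\int[leb]_(x in `[x0, x1]) ((g1 x)%:E * (seg g2 y0 y1)%:E))%E.
  apply: eq_integral => x _; rewrite i2 -ge0_integralZl//.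
  - by apply/measurable_EFinP.
  - by move=> y _; rewrite lee_fin.
  - by rewrite lee_fin.
rewrite ge0_integralZr//.
- by rewrite -i1 EFinM.
- by apply/measurable_EFinP.
- by move=> y _; rewrite lee_fin.
- by rewrite lee_fin; apply: Rintegral_ge0.
Qed.

End test_integrals.

(** * Peak functions at the boundary point 1 *)

Section peak.
Context {R : realType}.
Local Notation C := (cplx R).
Local Notation D := (@plane_disc R).
Local Notation leb2 := (@plane_lebesgue R).
Implicit Types (x y a b e r s t k M : R) (p : R * R) (z w : R[i]) (f g : A1 R).

(** A bump at the boundary point 1 with mass of order 1 at distance about [e]
    from it. The exponent is large enough for [normc_peak_le]. The power of
    [z] in the numerator makes composition with [phi t] simple, see
    [peak_phi]. *)
Definition peak e z : R[i] := (e ^+ 2)%:C * (z * (1 - (1 - e)%:C * z)^-1) ^+ 4.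

Lemma Re_peak_denominator e z :
  complex.Re (1 - (1 - e)%:C * z) = 1 - (1 - e) * complex.Re z.
Proof. by case: z => a b /=; rewrite mul0r subr0. Qed.

Lemma Im_peak_denominator e z :
  complex.Im (1 - (1 - e)%:C * z) = - ((1 - e) * complex.Im z).
Proof. by case: z => a b /=; rewrite mul0r addr0 sub0r. Qed.

Lemma disc_Re_lt1 z : disc z -> complex.Re z < 1.
Proof. by move=> Dz; apply: le_lt_trans (ler_norm _) _; apply: le_lt_trans (Re_le_normc z) _. Qed.

Lemma peak_denominator_ge e z : 0 < e -> e <= 1 -> disc z -> e <= complex.Re (1 - (1 - e)%:C * z).
Proof. by move=> e0 e1 /disc_Re_lt1 x1; rewrite Re_peak_denominator; nra. Qed.

Lemma peak_analytic e : 0 < e -> e <= 1 -> analytic_disc (peak e : C -> C).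
Proof.
move=> e0 e1 z Dz.
have nz : 1 - (1 - e)%:C * z != 0.
  apply/eqP => h; have := peak_denominator_ge e0 e1 Dz; rewrite h /= => /(lt_le_trans e0).
  by rewrite ltxx.
exact: (@derivable_peak R[i] _ _ z 4 nz).
Qed.

(** With [w = 1 - (1 - e) * z = u + i v], the factor [normc w ^+ 4] of the
    denominator is split into two factors [normc w ^+ 2]. One is bounded below
    by [u ^+ 2] and the other by half the square of [e + |y| / 2]. The result is a
    product of a function of [x] and a function of [y], each of integral of
    order [1 / e]. *)
Lemma normc_peak_le e z : 0 < e -> e <= 1 / 4 -> disc z ->
  normc (peak e z) <= 2 * e ^+ 2 * (1 + (- (1 - e)) * complex.Re z) ^- 2 *
    (e + `|complex.Im z| / 2) ^- 2.
Proof.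
move=> e0 e4 Dz; have e1 : e <= 1 by lra.
set w := 1 - (1 - e)%:C * z.
have we := peak_denominator_ge e0 e1 Dz; rewrite -/w in we.
have -> : 1 + (- (1 - e)) * complex.Re z = complex.Re w.
  by rewrite Re_peak_denominator mulNr.
set u := complex.Re w in we *; set v := complex.Im z.
have u0 : 0 < u by exact: lt_le_trans we.
have nw2 : normc w ^+ 2 = u ^+ 2 + ((1 - e) * v) ^+ 2.
  by rewrite normc_sqr Im_peak_denominator sqrrN.
have nw0 : 0 < normc w ^+ 2 by rewrite nw2 ltr_pwDl ?sqr_ge0// exprn_gt0.
have le1 : u ^+ 2 <= normc w ^+ 2 by rewrite nw2 lerDl sqr_ge0.
set q := e + `|v| / 2.
have v0 : 0 <= `|v| by [].
have q0 : 0 < q by rewrite ltr_wpDr// divr_ge0.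
have le2 : q ^+ 2 / 2 <= normc w ^+ 2.
  have v2 : v ^+ 2 = `|v| ^+ 2 by rewrite real_normK ?num_real.
  have uu : e ^+ 2 <= u ^+ 2 by rewrite lerXn2r ?nnegrE// ltW.
  have vv : `|v| ^+ 2 / 4 <= ((1 - e) * v) ^+ 2.
    rewrite exprMn v2 mulrC ler_wpM2r ?sqr_ge0//.
    have : 1 / 2 <= 1 - e by lra.
    by rewrite expr2; nra.
  rewrite nw2; apply: le_trans (lerD uu vv).
  by have := sqr_ge0 (e - `|v| / 2); rewrite /q !expr2; lra.
have -> : normc (peak e z) = e ^+ 2 * normc z ^+ 4 / (normc w ^+ 2) ^+ 2.
  rewrite /peak -/w normcM.
  have -> : normc ((e ^+ 2)%:C : R[i]) = e ^+ 2.
    by rewrite /= expr0n addr0 sqrtr_sqr ger0_norm// sqr_ge0.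
  have X4 c : normc (c ^+ 4) = normc c ^+ 4 by rewrite !exprS expr0 !mulr1 !normcM.
  by rewrite X4 normcM normcV exprMn exprVn -exprM mulrA.
have z4 : normc z ^+ 4 <= 1 by rewrite exprn_ile1 ?normc_ge0// ltW.
have e2 : 0 <= e ^+ 2 by rewrite sqr_ge0.
apply: (@le_trans _ _ (e ^+ 2 * (normc w ^+ 2) ^- 2)).
  by rewrite ler_wpM2r ?invr_ge0 ?sqr_ge0// ler_piMr.
have -> : 2 * e ^+ 2 * u ^- 2 * q ^- 2 = e ^+ 2 * (u ^- 2 * (q ^+ 2 / 2)^-1).
  by field; rewrite !gt_eqF.
rewrite ler_wpM2l// expr2 invfM; apply: ler_pM; rewrite ?invr_ge0 ?(ltW nw0)//.
  by rewrite lef_pV2 ?posrE// exprn_gt0.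
by rewrite lef_pV2 ?posrE// divr_gt0// exprn_gt0.
Qed.

Lemma seg_inv_sqr_abs e : 0 < e ->
  {in `[-1, 1], continuous (fun y => (e + `|y| / 2) ^- 2 : R)} /\
  seg (fun y => (e + `|y| / 2) ^- 2) (-1) 1 = 2 / (e * (e + 2^-1)).
Proof.
move=> e0; have cg : {in `[-1, 1], continuous (fun y => (e + `|y| / 2) ^- 2 : R)}.
  move=> y _; have q0 : e + `|y| / 2 != 0 by rewrite gt_eqF// ltr_wpDr// divr_ge0.
  have H : {for y, continuous (fun y => (e + `|y| / 2)^-1 : R)}.
    apply: cvgV => //; apply: cvgD; first exact: cvg_cst.
    by apply: cvgMl; apply: cvg_norm; exact: cvg_id.
  have -> : (fun y => (e + `|y| / 2) ^- 2 : R) = (fun y => (e + `|y| / 2)^-1 * (e + `|y| / 2)^-1).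
    by apply/funext => ?; rewrite expr2 invfM.
  exact: (cvgM H H).
split=> //; rewrite (seg_split (c := 0)) ?lerN10//.
have [_ E1] := @seg_inv_sqr _ e (2^-1) 0 1 ltac:(by rewrite invr_eq0) ler01
  ltac:(by move=> y /andP[y0 _]; rewrite ltr_wpDr// mulr_ge0// invr_ge0).
have [_ E2] := @seg_inv_sqr _ e (- 2^-1) (-1) 0 ltac:(by rewrite oppr_eq0 invr_eq0) ltac:(by rewrite lerN10)
  ltac:(by move=> y /andP[_ y0]; rewrite ltr_wpDr// mulr_le0// oppr_le0 invr_ge0).
have -> : seg (fun y => (e + `|y| / 2) ^- 2) 0 1 = seg (fun y => (e + 2^-1 * y) ^- 2) 0 1.
  by apply: eq_Rintegral => y; rewrite inE/= in_itv/= => /andP[y0 _]; rewrite ger0_norm// mulrC.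
have -> : seg (fun y => (e + `|y| / 2) ^- 2) (-1) 0 = seg (fun y => (e + - 2^-1 * y) ^- 2) (-1) 0.
  by apply: eq_Rintegral => y; rewrite inE/= in_itv/= => /andP[_ y0]; rewrite ler0_norm// mulrC mulNr mulrN.
rewrite E1 E2; field.
by rewrite !gt_eqF//; lra.
Qed.

Lemma peak_in_A1 e : 0 < e -> e <= 1 / 4 ->
  exists2 f : A1 R, (forall z, disc z -> f z = peak e z) & A1_norm f <= 16.
Proof.
move=> e0 e4; have e1 : e <= 1 by lra.
have de x : x <= 1 -> e <= 1 + (- (1 - e)) * x by move=> x1; nra.
have e20 : 0 <= 2 * e ^+ 2 by have := sqr_ge0 e; lra.
have Xnn (c : R) : 0 <= c ^- 2 by rewrite invr_ge0 sqr_ge0.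
have [f fE] : exists f : A1 R, forall z, disc z -> f z = peak e z.
  apply: (@bounded_A1 _ (peak e : C -> C) (2 * e ^+ 2 * e ^- 2 * e ^- 2)); first exact: peak_analytic.
  move=> z Dz; apply: le_trans (normc_peak_le e0 e4 Dz) _.
  have Dx := de _ (ltW (disc_Re_lt1 Dz)).
  apply: ler_pM; rewrite ?mulr_ge0 ?Xnn ?sqr_ge0 ?(ltW e0)//.
    rewrite ler_wpM2l// lef_pV2 ?posrE ?exprn_gt0//; last exact: lt_le_trans Dx.
    by rewrite lerXn2r ?nnegrE ?(ltW e0)// (le_trans (ltW e0)).
  have q0 : e <= e + `|complex.Im z| / 2 by rewrite lerDl divr_ge0.
  rewrite lef_pV2 ?posrE ?exprn_gt0//; last exact: lt_le_trans q0.
  by rewrite lerXn2r ?nnegrE ?(ltW e0)// (le_trans (ltW e0)).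
exists f => //.
have [c1 E1] := @seg_inv_sqr _ 1 (- (1 - e)) (-1) 1 ltac:(by rewrite oppr_eq0 gt_eqF//; lra) ltac:(lra)
  ltac:(by move=> x /andP[_ x1]; exact: lt_le_trans (de x x1)).
have [c2 E2] := seg_inv_sqr_abs e0.
pose g1 x := 2 * e ^+ 2 * (1 + (- (1 - e)) * x) ^- 2; pose g2 y := (e + `|y| / 2) ^- 2.
have cg1 : {in `[-1, 1], continuous (g1 : R -> R)} by move=> x xx; apply: cvgMr; exact: c1.
have g10 x : 0 <= g1 x by apply: mulr_ge0; [exact: e20|exact: Xnn].
have g20 x : 0 <= g2 x by exact: Xnn.
have seg1 : seg g1 (-1) 1 = 2 * e ^+ 2 * (2 / ((2 - e) * e)).
  rewrite /seg RintegralZl//; last exact: seg_integrable.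
  by rewrite -/(seg _ _ _) E1; congr (_ * (_ / _)); [lra|ring].
have key : pi * A1_norm f <= seg g1 (-1) 1 * seg g2 (-1) 1.
  rewrite -lee_fin -integral_absA1 -integral_box_product//.
  have mg : measurable_fun (box (-1) 1 (-1) 1 : set (measurableTypeR R * measurableTypeR R))
      (fun p => (g1 p.1 * g2 p.2)%:E).
    apply/measurable_EFinP; apply: continuous_plane_measurable; first exact: measurable_box.
    move=> [x y] [/= xx yy]; apply: cvgM.
      by apply: (@continuous_comp _ _ _ fst g1); [exact: cvg_fst|exact: cg1].
    by apply: (@continuous_comp _ _ _ snd g2); [exact: cvg_snd|exact: c2].
  have g0 p : (0 <= (g1 p.1 * g2 p.2)%:E)%E by rewrite lee_fin mulr_ge0.
  have sub := @plane_disc_box R.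
  apply: (@le_trans _ _ (\int[leb2]_(p in D) (g1 p.1 * g2 p.2)%:E)%E); last first.
    by apply: ge0_subset_integral => //; [exact: measurable_disc|exact: measurable_box].
  apply: ge0_le_integral => //; first exact: measurable_disc.
  - by move=> p _; rewrite lee_fin normc_ge0.
  - by have /integrableP[] := integrable_absA1 f.
  - by apply: measurable_funS mg => //; exact: measurable_box.
  - move=> [x y] Dp; rewrite lee_fin /absA1 fE//.
    exact: (normc_peak_le e0 e4 Dp).
(* The product of the two integrals is 8 / ((2 - e) * (e + 1 / 2)). *)
have pi1 : 1 <= pi :> R by apply: le_trans (pi_ge2 R); rewrite ler1n.
have N0 := A1_norm_ge0 f.
have : pi * A1_norm f <= 16.
  apply: le_trans key _; rewrite seg1 E2.
  have -> : 2 * e ^+ 2 * (2 / ((2 - e) * e)) * (2 / (e * (e + 2^-1))) = 8 / ((2 - e) * (e + 2^-1)).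
    by field; rewrite !gt_eqF//; lra.
  by rewrite ler_pdivrMr ?mulr_gt0//; nra.
nra.
Qed.

End peak.

(** * Absence of cancellation near the point 1 *)

Section sector.
Context {R : realType}.
Implicit Types (x y a b c e t : R) (z w : R[i]).

Definition sector a z : Prop := 0 < complex.Re z /\ `|complex.Im z| <= a * complex.Re z.

(** Addition of arguments: [a], [b] and [c] are tangents, and the hypothesis
    says that [c] is at least the tangent of the sum of the angles. *)
Lemma sectorM a b c w z : 0 <= a -> 0 <= b -> a * b < 1 -> a + b <= c * (1 - a * b) ->
  sector a w -> sector b z -> sector c (w * z).
Proof.
case: w z => [w1 w2] [z1 z2] a0 b0 ab abc [/= w0 wa] [/= z0 zb].
have wz0 : 0 < w1 * z1 by rewrite mulr_gt0.
have im : `|w2| * `|z2| <= a * b * (w1 * z1).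
  by rewrite mulrACA; apply: ler_pM.
have re : (1 - a * b) * (w1 * z1) <= w1 * z1 - w2 * z2.
  rewrite mulrBl mul1r lerD2l lerN2; apply: le_trans (ler_norm _) _.
  by rewrite normrM.
have ab0 : 0 < 1 - a * b by rewrite subr_gt0.
split; first by apply: lt_le_trans re; rewrite mulr_gt0.
have c0 : 0 <= c by rewrite -(pmulr_lge0 _ ab0); apply: le_trans abc; exact: addr_ge0.
apply: (@le_trans _ _ ((a + b) * (w1 * z1))).
  apply: le_trans (ler_normD _ _) _; rewrite !normrM mulrDl addrC.
  rewrite (gtr0_norm w0) (gtr0_norm z0); apply: lerD.
    by have := ler_wpM2r (ltW z0) wa; rewrite /=; lra.
  by have := ler_wpM2l (ltW w0) zb; lra.
apply: (@le_trans _ _ (c * ((1 - a * b) * (w1 * z1)))); last exact: ler_wpM2l.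
by rewrite [leRHS]mulrA; apply: ler_wpM2r => //; exact: ltW.
Qed.

(** The tangents of two and of four times the angle of tangent 1/10 are below
    21/100 and 1/2, which leaves room for one more factor below 1. *)
Lemma sector_power z w : sector (1 / 10) z -> sector (1 / 10) w ->
  sector 1 (z * z * (z * z) * w).
Proof.
move=> sz sw; have sz2 : sector (21 / 100) (z * z).
  by apply: (@sectorM (1 / 10) (1 / 10)) => //; lra.
have sz4 : sector (1 / 2) (z * z * (z * z)).
  by apply: (@sectorM (21 / 100) (21 / 100)) => //; lra.
by apply: (@sectorM (1 / 2) (1 / 10)) => //; lra.
Qed.

Lemma sector_Re_inv w c : sector 1 w -> normc w <= c -> (2 * c)^-1 <= complex.Re w^-1.
Proof.
case: w => [w1 w2] [/= w0]; rewrite mul1r => w21 wc.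
have w1c : w1 <= c.
  by apply: le_trans wc; apply: le_trans (ler_norm _) _; exact: (Re_le_normc (w1 +i* w2)).
have c0 : 0 < c by exact: lt_le_trans w1c.
have w22 : w2 ^+ 2 <= w1 ^+ 2.
  by rewrite -(real_normK (num_real w2)) lerXn2r ?nnegrE// ltW.
have n0 : 0 < w1 ^+ 2 + w2 ^+ 2 by rewrite ltr_pwDl ?sqr_ge0// exprn_gt0.
rewrite ler_pdivlMr// mulrC ler_pdivrMr ?mulr_gt0//; nra.
Qed.

(** [|1 + (t - 1) * z| >= 1 - (1 - t) * |z| > t]. *)
Lemma phi_disc t z : 0 <= t < 1 -> disc z -> disc (phi t z).
Proof.
move=> /andP[t0 t1] Dz; have z1 : normc z < 1 by [].
have A_gt : t < normc (1 + (t - 1)%:C * z).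
  have : 1 <= normc (1 + (t - 1)%:C * z) + (1 - t) * normc z.
    have <- : normc (- ((t - 1)%:C * z)) = (1 - t) * normc z.
      rewrite normcN normcM; congr (_ * _).
      by rewrite /= expr0n addr0 sqrtr_sqr -opprB normrN ger0_norm// subr_ge0 ltW.
    by apply: le_trans (le_normcD _ _); rewrite addrK normc1.
  by have := normc_ge0 z; nra.
have A0 : 0 < normc (1 + (t - 1)%:C * z) by exact: le_lt_trans A_gt.
change (is_true (normc (phi t z) < 1)).
rewrite /phi normcM normcV ltr_pdivrMr// mul1r.
by rewrite /= expr0n addr0 sqrtr_sqr ger0_norm.
Qed.

(** With [A = 1 + (t - 1) * z] one has [phi t z = t / A] and
    [weight t z = 1 / A], and the powers of [A] cancel except for one. *)
Lemma peak_phi (F : fieldType) (E T S A : F) : A != 0 -> A - S * T != 0 ->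
  E * (T / A * (1 - S * (T / A))^-1) ^+ 4 * A^-1 =
  E * T ^+ 4 * ((A - S * T) * (A - S * T) * ((A - S * T) * (A - S * T)) * A)^-1.
Proof.
move=> A0 B0.
have -> : T / A * (1 - S * (T / A))^-1 = T / (A - S * T).
  by field; rewrite ?A0 ?B0.
by field; rewrite ?A0 ?B0.
Qed.

(** In the window [A = 1 + (t - 1) * z] and [B = A - (1 - e) * t] have positive
    real parts [1 - (1 - t) * x] and [(1 - t) * (1 - x) + e * t] and both have
    the imaginary part [- (1 - t) * y], which is at most a tenth of either. So
    [B ^+ 4 * A] lies in the sector [|Im| <= Re]. Its modulus is at most
    [(3 * e) ^+ 4 * 2], whence the constant [324 = 2 * 3 ^ 4 * 2]. *)
Lemma peak_lower_bound e t x y : 0 < e -> e <= 1 / 4 -> 0 <= t < 1 ->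
  1 - 2 * e <= x <= 1 - e -> `|y| <= e / 10 ->
  t ^+ 4 / (324 * e ^+ 2) <= complex.Re (peak e (phi t (x +i* y)) * weight t (x +i* y)).
Proof.
move=> e0 e4 /andP[t0 t1] /andP[xl xu] ye; set z := x +i* y.
set A : R[i] := 1 + (t - 1)%:C * z; set B : R[i] := A - (1 - e)%:C * t%:C.
have ReA : complex.Re A = 1 - (1 - t) * x by rewrite /A /z /= mul0r; ring.
have ImA : complex.Im A = - ((1 - t) * y) by rewrite /A /z /= mul0r; ring.
have ReB : complex.Re B = (1 - t) * (1 - x) + e * t.
  have -> : complex.Re B = complex.Re A - (1 - e) * t.
    by rewrite /B; case: (A) => a b /=; rewrite mulr0 subr0.
  by rewrite ReA; ring.
have ImB : complex.Im B = - ((1 - t) * y).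
  by rewrite -ImA /B; case: (A) => a b /=; rewrite mulr0 mul0r addr0 subr0.
have y1 : - (e / 10) <= y <= e / 10 by rewrite -ler_norml.
move: y1 => /andP[yl yu].
have tA : (1 - t) * (e / 10) <= 1 / 10 * (1 - (1 - t) * x) by nra.
have tB : (1 - t) * (e / 10) <= 1 / 10 * ((1 - t) * (1 - x) + e * t) by nra.
have Im_le : `|- ((1 - t) * y)| <= (1 - t) * (e / 10).
  by rewrite normrN normrM ger0_norm ?subr_ge0 ?(ltW t1)// ler_wpM2l// subr_ge0 ltW.
have ReA0 : 0 < 1 - (1 - t) * x by nra.
have ReB0 : 0 < (1 - t) * (1 - x) + e * t by nra.
have sA : sector (1 / 10) A by split; rewrite ReA ?ImA//; exact: le_trans tA.
have sB : sector (1 / 10) B by split; rewrite ReB ?ImB//; exact: le_trans tB.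
have sW := sector_power sB sA.
have nA : normc A <= 2.
  apply: le_trans (normc_le_ReIm _) _; rewrite ReA ImA gtr0_norm//.
  by apply: le_trans (lerD (lexx _) Im_le) _; nra.
have nB : normc B <= 3 * e.
  apply: le_trans (normc_le_ReIm _) _; rewrite ReB ImB gtr0_norm//.
  by apply: le_trans (lerD (lexx _) Im_le) _; nra.
have nW : normc (B * B * (B * B) * A) <= 162 * e ^+ 4.
  rewrite !normcM; have -> : 162 * e ^+ 4 = (3 * e * (3 * e) * (3 * e * (3 * e))) * 2 by ring.
  have := normc_ge0 A; have := normc_ge0 B => B0 A0.
  by rewrite !ler_pM ?mulr_ge0.
have nz (w : R[i]) : 0 < complex.Re w -> w != 0 by case: w => a b /=; rewrite eq_complex /= => h; rewrite gt_eqF.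
have A0 : A != 0 by apply: nz; case: sA.
have B0 : B != 0 by apply: nz; case: sB.
have -> : peak e (phi t z) * weight t z = ((e ^+ 2 * t ^+ 4)%:C) * (B * B * (B * B) * A)^-1.
  have -> : (e ^+ 2 * t ^+ 4)%:C = (e ^+ 2)%:C * t%:C ^+ 4 :> R[i].
    by rewrite rmorphM (rmorphXn _ 4).
  by rewrite /peak /phi /weight -/A peak_phi.
have -> : complex.Re ((e ^+ 2 * t ^+ 4)%:C * (B * B * (B * B) * A)^-1) =
    e ^+ 2 * t ^+ 4 * complex.Re (B * B * (B * B) * A)^-1.
  by case: (_^-1) => a b /=; rewrite mul0r subr0.
apply: le_trans (ler_wpM2l _ (sector_Re_inv sW nW)); last by rewrite mulr_ge0// ?sqr_ge0 ?exprn_ge0.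
rewrite le_eqVlt; apply/orP; left; apply/eqP; field; rewrite gt_eqF//.
Qed.

End sector.

(** * Mass away from 0 destroys compactness *)

Section noncompact.
Context {R : realType}.
Local Notation C := (cplx R).
Local Notation D := (@plane_disc R).
Local Notation leb2 := (@plane_lebesgue R).
Implicit Types (mu : probability (measurableTypeR R) R).
Implicit Types (x y a b c e t : R) (p : R * R) (z w : R[i]) (f g : A1 R).

Lemma integrable_pow4 mu : mu.-integrable `[0, 1[ (EFin \o (fun t : measurableTypeR R => t ^+ 4)).
Proof.
apply: measurable_bounded_integrable => //.
  by apply: le_lt_trans (probability_le1 mu _) _ => //; exact: ltry.
exists 1; split; first exact: num_real.
move=> M M1 t; rewrite /= in_itv/= => /andP[t0 t1]; apply: le_trans (ltW M1).
by rewrite ger0_norm ?exprn_ge0// exprn_ile1// ltW.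
Qed.

Lemma moment_gt0 mu : mu `]0, 1[%classic != 0%E ->
  0 < \int[mu]_(t in `[0, 1[) (t ^+ 4).
Proof.
move=> mu01; rewrite lt_neqAle Rintegral_ge0 ?andbT => [|t]; last first.
  by rewrite /= in_itv/= => /andP[t0 _]; rewrite exprn_ge0.
apply: contra mu01 => /eqP m0.
have i4 := integrable_pow4 mu; have /integrableP[m4 _] := i4.
have : (\int[mu]_(t in `[0%R, 1%R[) `|(t ^+ 4)%:E| = 0)%E.
  transitivity (\int[mu]_(t in `[0, 1[) (t ^+ 4))%:E; last by rewrite -m0.
  rewrite fineK; last exact: integrable_fin_num i4.
  apply: eq_integral => t; rewrite inE/= in_itv/= => /andP[t0 _].
  by rewrite ger0_norm// exprn_ge0.
move=> /(ae_eq_integral_abs _ _ m4) [] // N [mN N0 UN].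
rewrite -measure_le0 -N0; apply: le_measure; rewrite ?inE//.
move=> t; rewrite /= in_itv/= => /andP[t0 t1]; apply: UN => /=.
rewrite in_itv/= (ltW t0) t1 => /(_ isT)/eqP; rewrite eqe expf_eq0/=.
by rewrite gt_eqF.
Qed.

Lemma is_Gamma_peak_lower mu (T : A1 R -> A1 R) f e x y : is_Gamma mu T -> 0 < e -> e <= 1 / 4 ->
  (forall z, disc z -> f z = peak e z) -> 1 - 2 * e <= x <= 1 - e -> `|y| <= e / 10 ->
  disc (x +i* y) ->
  (\int[mu]_(t in `[0, 1[) (t ^+ 4)) / (324 * e ^+ 2) <= normc (T f (x +i* y)).
Proof.
move=> GT e0 e4 fE xx yy Dz; have [[ire _] TE] := GT f _ Dz.
apply: le_trans (Re_le_normc _); apply: le_trans (ler_norm _).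
rewrite TE /cintegral /= -RintegralZr//; last exact: integrable_pow4.
apply: le_Rintegral => //.
  have mI : measurable (`[0, 1[%classic : set (measurableTypeR R)) by exact: measurable_itv.
  have := integrableZr mI (324 * e ^+ 2)^-1 (integrable_pow4 mu).
  by apply: eq_integrable.
move=> t; rewrite /= in_itv/= => t01; rewrite fE; last exact: phi_disc.
exact: peak_lower_bound.
Qed.

Definition window e : set (R * R) := box (1 - 2 * e) (1 - e) (- (e / 10)) (e / 10).

Lemma window_disc e : 0 < e -> e <= 1 / 4 -> window e `<=` D.
Proof.
move=> e0 e4 [x y] [/=]; rewrite !in_itv/= => /andP[xl xu]; rewrite -ler_norml => yy.
change (is_true (normc (x +i* y) < 1)).
rewrite -(ltr_pXn2r (n := 2)) ?nnegrE ?normc_ge0// expr1n normc_sqr /=.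
have : `|y| ^+ 2 <= (e / 10) ^+ 2 by rewrite lerXn2r ?nnegrE// divr_ge0// ltW.
rewrite real_normK ?num_real//; nra.
Qed.

Lemma window_leaves (e_ : nat -> R) p : D p -> e_ n @[n --> \oo] --> (0 : R) ->
  \forall n \near \oo, ~ window (e_ n) p.
Proof.
case: p => x y Dp e_to0; have x1 : x < 1 := disc_Re_lt1 Dp.
have h : 0 < (1 - x) / 2 by rewrite divr_gt0// subr_gt0.
move/cvgrPdist_lt : e_to0 => /(_ _ h); apply: filterS => n.
rewrite sub0r normrN => /(le_lt_trans (ler_norm _)) en [/=].
rewrite in_itv/= => /andP[+ _] _; lra.
Qed.

(** The constant 1620 comes from the lower bound [m / (324 * e ^+ 2)] for
    [|T f|] and the area [e * (e / 5)] of the window. *)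
Theorem compact_no_mass mu (T : A1 R -> A1 R) : is_Gamma mu T -> compact_operator T ->
  mu `]0, 1[%classic = 0%E.
Proof.
move=> GT cT; apply/eqP; apply: contrapT => /negP /moment_gt0 m0.
set m := \int[mu]_(t in _) _ in m0.
pose e n : R := n.+4%:R^-1.
have e0 n : 0 < e n by rewrite invr_gt0 ltr0n.
have e4 n : e n <= 1 / 4 by rewrite div1r lef_pV2 ?posrE ?ltr0n// ler_nat.
have /choice[u uP] n : exists f : A1 R, (forall z, disc z -> f z = peak (e n) z) /\ A1_norm f <= 16.
  by have [f fE f16] := peak_in_A1 (e0 n) (e4 n); exists f.
have bu : bounded_fun u by apply/bounded_fun_A1; exists 16 => n; case: (uP n).
have [s si /cvg_ex[/= g cvg_g]] := cT u bu.
have lower n : m / 1620 <= \int[leb2]_(p in D `&` window (e (s n))) absA1 (T (u (s n))) p.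
  have [fE _] := uP (s n); set c := e (s n) in fE *.
  have [c0 c4] : 0 < c /\ c <= 1 / 4 by split; [exact: e0|exact: e4].
  rewrite setIidr; last exact: window_disc.
  have <- : \int[leb2]_(p in window c) (m / (324 * c ^+ 2)) = m / 1620.
    rewrite Rintegral_cst; last exact: measurable_box.
    have -> : fine (leb2 (window c)) = (1 - c - (1 - 2 * c)) * (c / 10 - - (c / 10)).
      by rewrite plane_lebesgue_box//; lra.
    by field; rewrite gt_eqF.
  have mW := @measurable_box R (1 - 2 * c) (1 - c) (- (c / 10)) (c / 10).
  apply: le_Rintegral => //.
  - apply: measurable_bounded_integrable => //.
    + by rewrite plane_lebesgue_box ?ltry//; lra.
    + exact: bounded_cst.
  - apply: integrableS (integrable_absA1 _); [exact: measurable_disc|exact: measurable_box|].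
    exact: window_disc.
  - move=> [x y] Wp; have := window_disc c0 c4 Wp; move: Wp => [/=].
    rewrite !in_itv/= -ler_norml => xx yy Dz.
    exact: (is_Gamma_peak_lower GT c0 c4 fE xx yy Dz).
have e_to0 : e (s n) @[n --> \oo] --> (0 : R).
  apply: (cvg_subseq si); apply/cvgrPdist_lt => c c0.
  apply: filterS (near_infty_natSinv_lt (PosNum c0)) => n /=.
  rewrite sub0r normrN gtr0_norm//; apply: le_lt_trans.
  by rewrite lef_pV2 ?posrE ?ltr0n// ler_nat ltnS -[X in (_ <= X)%N]addn3 leq_addr.
have k0 : 0 < m / 1620 by lra.
move: (m / 1620) k0 lower => k k0 lower.
have c0 : 0 < k / 4 by rewrite divr_gt0.
have small : \forall n \near \oo, \int[leb2]_(p in D `&` window (e (s n))) `|absA1 g p| < k / 4.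
  apply: integral_vanish => //; [exact: measurable_disc|exact: integrable_absA1| |].
    by move=> n; exact: measurable_box.
  by move=> p Dp; exact: window_leaves.
have pc0 : 0 < k / 4 / pi by apply: divr_gt0 => //; exact: pi_gt0.
move/A1_cvgP : cvg_g => /(_ _ pc0) close.
have [n [n1 n2]] := filter_ex (filterI small close).
have := lower n; apply/negP; rewrite -ltNge.
set E := D `&` window _ in n1 *.
have mE : measurable (E : set (measurableTypeR R * measurableTypeR R)).
  by apply: measurableI; [exact: measurable_disc|exact: measurable_box].
have subE : E `<=` D by exact: subIsetl.
have iE f : leb2.-integrable E (EFin \o absA1 f).
  by apply: integrableS (integrable_absA1 f) => //; exact: measurable_disc.
set h := T (u (s n)) in n2 *.
apply: (@le_lt_trans _ _ (\int[leb2]_(p in E) (absA1 (h - g) p + absA1 g p))).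
  apply: le_Rintegral => //; first by apply: integrable_funD.
  move=> p _; rewrite /absA1.
  have -> : h (of_plane p) = (h - g) (of_plane p) + g (of_plane p) by rewrite -[RHS]/((h - g + g) (of_plane p)) subrK.
  exact: le_normcD.
rewrite RintegralD//.
have le1 : \int[leb2]_(p in E) absA1 (h - g) p <= pi * A1_norm (h - g).
  rewrite -lee_fin -integral_absA1 /Rintegral fineK; last exact: integrable_fin_num (iE _).
  apply: ge0_subset_integral => //; first exact: measurable_disc.
    by have /integrableP[] := integrable_absA1 (h - g).
  by move=> p _; rewrite lee_fin normc_ge0.
have le2 : \int[leb2]_(p in E) absA1 g p < k / 4.
  apply: le_lt_trans n1; apply: le_Rintegral => //; first exact: integrable_norm.
  by move=> p _; exact: ler_norm.
move: n2; rewrite ltr_pdivlMr ?pi_gt0// mulrC => n2; lra.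
Qed.

Lemma no_mass_dirac0 mu : mu `[0, 1[%classic = 1%E -> mu `]0, 1[%classic = 0%E ->
  forall A, measurable A -> mu A = \d_(0 : R) A.
Proof.
move=> mu1 mu0 A mA; have m0 : measurable ([set 0] : set (measurableTypeR R)) by exact: measurable_set1.
have mu_pt : mu [set 0] = 1%E.
  have := mu1; rewrite (_ : `[0, 1[%classic = [set 0] `|` `]0, 1[%classic :> set R).
    rewrite measureU//; last first.
      by apply/seteqP; split=> // t [/= ->]; rewrite in_itv/= ltxx.
    by move: mu0 => /= ->; rewrite adde0.
  apply/seteqP; split=> t /=; rewrite !in_itv/=.
    by rewrite le_eqVlt => /andP[/predU1P[<-|-> ->]]; [left|right].
  by case=> [->|/andP[/ltW-> ->]//]; rewrite lexx ltr01.
rewrite diracE; have [A0|nA0] := boolP (0 \in A).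
  apply/eqP; rewrite eq_le probability_le1//= -mu_pt.
  by apply: le_measure; rewrite ?inE// => t ->; exact/set_mem.
apply/eqP; rewrite -measure_le0; apply: (@le_trans _ _ (mu (~` [set 0]))).
  apply: le_measure; rewrite ?inE//; first exact: measurableC.
  by move=> t At /= t0; move: nA0; rewrite -t0 => /negP; apply; exact/mem_set.
by rewrite probability_setC// mu_pt subee.
Qed.

End noncompact.

Theorem theorem1p3 (R : realType) :
  (forall (mu : probability (measurableTypeR R) R) (T : {linear A1 R -> A1 R}),
      mu `[0%R, 1%R[%classic = 1%E -> is_Gamma mu T -> bounded_operator T ->
      (compact_operator T <-> forall A, measurable A -> mu A = \d_(0 : R) A)) /\
  (forall (mu : probability (measurableTypeR R) R) (T : {linear A1 R -> A1 R}),
      mu `[0%R, 1%R[%classic = 1%E -> is_Gamma mu T -> bounded_operator T ->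
      completely_continuous T).
Proof.
split=> [mu T mu1 GT bT|mu T _ _]; last exact: bounded_completely_continuous.
split=> [cT|mu0]; last exact: dirac0_compact mu0 GT.
by apply: no_mass_dirac0 => //; exact: compact_no_mass GT cT.
Qed.
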